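(* Let $0<q<1$. Let $z\in\mathbb{Z}$ and let $R,x,y,\nu\in\mathbb{C}$ satisfy $R\neq 0$, $\Re(x)>-1$ and $q^{1+\Re(x)+\Re(y)}|R|^2<1$. Then $$ J_\nu\bigl(Rq^{\frac12(y+z+\nu)};q\bigr)\,J_{x-\nu}\bigl(q^{\frac12 z};q\bigr) =\sum_{k=-\infty}^{\infty} J_k\bigl(Rq^{\frac12(x+y+k)};q\bigr)\,J_{\nu+k}\bigl(Rq^{\frac12(y+k+\nu)};q\bigr)\,J_x\bigl(q^{\frac12(z-k)};q\bigr). $$
   Context: For $0<q<1$ put $(a;q)_0=1$, $(a;q)_k=\prod_{i=0}^{k-1}(1-aq^i)$ for $k\ge 1$, and $(a;q)_\infty=\lim_{k\to\infty}(a;q)_k$. The Hahn-Exton $q$-Bessel function of order $\alpha\in\mathbb{C}$ is $$ J_\alpha(z;q)=z^\alpha\frac{(q^{\alpha+1};q)_\infty}{(q;q)_\infty}\,{}_1\varphi_1\!\left({0\atop q^{\alpha+1}};q,qz^2\right) = z^\alpha \sum_{k=0}^\infty \frac{(q^{\alpha+k+1};q)_\infty}{(q;q)_\infty}\,\frac{(-1)^k q^{\frac12 k(k+1)}}{(q;q)_k}\,z^{2k}, $$ where the last expression is used as the definition also when $(q^{\alpha+1};q)_k$ vanishes for some $k$ (e.g. when $\alpha$ is a negative integer). Powers: $q^a=e^{a\log q}$ with $\log q$ real, for all $a\in\mathbb{C}$. One fixes a value of $\log R$ and puts $R^\alpha=e^{\alpha\log R}$; then $z^\alpha$ for $z=Rq^a$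 means $R^\alpha q^{a\alpha}$, and for $z=q^a$ means $q^{a\alpha}$. *)

(* Defs.v *)
(* Stdlib reals with Coquelicot; complex numbers are Coquelicot's [C]. *)
From Stdlib Require Export Reals ZArith.
From Coquelicot Require Export Coquelicot.

Open Scope R_scope.
Open Scope C_scope.

Definition Cexp (w : C) : C :=
  (exp (Re w) * cos (Im w), exp (Re w) * sin (Im w))%R.

(* q^a for a real base q > 0 and a complex exponent, with log q real. *)
Definition qpow (q : R) (a : C) : C := Cexp (a * ln q).

(* [iota] picks the unique element satisfying a predicate, so the two limit
   operators below carry a meaning only when the limit exists; it always does
   in [HahnExton] for 0 < q < 1. *)
Definition Clim_seq (u : nat -> C) : C :=
  iota (T := C_CompleteNormedModule) (fun l : C => filterlim u eventually (locally l)).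

Definition Cseries (a : nat -> C) : C :=
  iota (T := C_CompleteNormedModule) (fun l : C => is_series a l).

(* (a;q)_k *)
Fixpoint qpoch (a : C) (q : R) (k : nat) : C :=
  match k with
  | O => 1
  | S i => qpoch a q i * (1 - a * q ^ i)
  end.

(* (a;q)_oo *)
Definition qpoch_inf (a : C) (q : R) : C := Clim_seq (qpoch a q).

(* J_alpha(z;q).  As z^alpha is multivalued, its chosen value is the separate
   argument [zalpha].  The division k(k+1)/2 in [nat] is exact. *)
Definition HahnExton (q : R) (alpha z zalpha : C) : C :=
  zalpha * Cseries (fun k : nat =>
    qpoch_inf (qpow q (alpha + INR k + 1)) q / qpoch_inf q q
    * ((- (1)) ^ k * q ^ (k * (k + 1) / 2) / qpoch q q k)
    * z ^ (2 * k)).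

(* J_alpha(q^a;q), where z^alpha means q^(a alpha). *)
Definition J_qpow (q : R) (alpha a : C) : C :=
  HahnExton q alpha (qpow q a) (qpow q (a * alpha)).

(* J_alpha(r q^a;q), where [logr] is the chosen logarithm of r and z^alpha
   means r^alpha q^(a alpha) with r^alpha = e^(alpha logr). *)
Definition J_Rqpow (q : R) (r logr alpha a : C) : C :=
  HahnExton q alpha (r * qpow q a) (Cexp (alpha * logr) * qpow q (a * alpha)).

(* The bilateral series of f over all of Z converges to l: both one-sided
   series converge, with sums adding up to l. *)
Definition is_biseries (f : Z -> C) (l : C) : Prop :=
  exists l1 l2 : C,
    is_series (fun n : nat => f (Z.of_nat n)) l1 /\
    is_series (fun n : nat => f (- Z.of_nat (S n))%Z) l2 /\
    l = l1 + l2.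

(* Main.v *)
Require Import Defs.
From Stdlib Require Import Lra Lia List Permutation ClassicalEpsilon.
Import ListNotations.

(** Write N = q^nu, X = q^x, t = R^2 q^y, Z = q^z, P = (q;q)_oo and

      E(A;u) = sum_m (A q^(m+1);q)_oo / P * (-1)^m q^(m(m+1)/2) / (q;q)_m * u^m,

    so that J_alpha(z;q) = z^alpha E(q^alpha; z^2).  After cancellation of common
    powers the addition formula reads

      E(N; t N Z) E(X/N; Z)
        = sum_k t^k q^(k^2) N^k E(q^k; t X q^k) E(N q^k; t N q^k) E(X; Z q^(-k)).

    The three series on the right are expanded, with indices m, b, d.  Since
    (q^(k+m+1);q)_oo / P is 1/(q;q)_(k+m), and 0 if k + m < 0, the sum over k
    becomes a sum over j = k + m >= 0.  The resulting quadruple series is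
    summed in another order.

    - For fixed j, b, d, with n = j + b, the sum over m is a q-binomial series
      ([has_sum_quad_m], from [q_binomial]): it replaces (X q^(d+1);q)_oo by
      (X q^(d+1-n)/N;q)_oo.
    - The sum over j + b = n is a finite q-binomial sum ([csum_triple], from
      [finite_q_binomial]) equal to (q^(-d);q)_n/(q;q)_n up to sign.
    - This vanishes for d < n, and after the shift d -> n + d what remains is
      the product of the series of E(N; t N Z) and E(X/N; Z)
      ([double_term_shift]).

    The rearrangement is legitimate because the quadruple series converges
    absolutely when |q X| < 1 and |q t X| < 1 ([summable_quad_term]).
    The estimate is made on the logarithm of the terms, where it becomes an
    inequality between quadratic polynomials in the indices
    ([quad_exponent_bound]).  Sums are taken over the net of finite sets of
    indices ([has_sum]), which makes changes of variables and of the order of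
    summation independent of enumerations. *)

(** * Finite sums over lists and unordered summation *)

Definition csum {I : Type} (f : I -> C) (s : list I) : C :=
  fold_right (fun i acc => f i + acc) 0 s.

Definition rsum {I : Type} (p : I -> R) (s : list I) : R :=
  fold_right (fun i acc => p i + acc)%R 0%R s.

(** Convergence along the net of finite subsets, represented by duplicate-free
    lists.  All rearrangements of the proof are then instances of a
    reindexing lemma and of one Fubini lemma, whatever the index type. *)
Definition has_sum {I : Type} (f : I -> C) (l : C) : Prop :=
  forall eps : R, (0 < eps)%R ->
  exists s0 : list I,
    forall s, NoDup s -> incl s0 s -> (Cmod (csum f s - l) < eps)%R.

(** Used for families p with nonnegative values, where it is the finiteness of
    the sum. *)
Definition summable {I : Type} (p : I -> R) : Prop :=
  exists B : R, forall s, NoDup s -> (rsum p s <= B)%R.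

Lemma csum_app {I} (f : I -> C) s t : csum f (s ++ t) = csum f s + csum f t.
Proof. induction s as [|a s IH]; simpl; [|rewrite IH]; ring. Qed.

Lemma rsum_app {I} (p : I -> R) s t : rsum p (s ++ t) = (rsum p s + rsum p t)%R.
Proof. induction s as [|a s IH]; simpl; [|rewrite IH]; ring. Qed.

Lemma csum_perm {I} (f : I -> C) s t : Permutation s t -> csum f s = csum f t.
Proof. induction 1; simpl; try congruence; try ring. Qed.

Lemma rsum_perm {I} (p : I -> R) s t : Permutation s t -> rsum p s = rsum p t.
Proof. induction 1; simpl; try congruence; try ring. Qed.

Lemma csum_map {I J} (phi : I -> J) (f : J -> C) s :
  csum f (map phi s) = csum (fun i => f (phi i)) s.
Proof. induction s as [|a s IH]; simpl; [|rewrite IH]; ring. Qed.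

Lemma rsum_map {I J} (phi : I -> J) (p : J -> R) s :
  rsum p (map phi s) = rsum (fun i => p (phi i)) s.
Proof. induction s as [|a s IH]; simpl; [|rewrite IH]; ring. Qed.

Lemma csum_ext {I} (f g : I -> C) s :
  (forall i, In i s -> f i = g i) -> csum f s = csum g s.
Proof.
  induction s as [|a s IH]; intros H; simpl; [reflexivity|].
  rewrite H by (left; reflexivity). rewrite IH; [reflexivity|].
  intros i Hi; apply H; right; exact Hi.
Qed.

Lemma csum_plus {I} (f g : I -> C) s :
  csum (fun i => f i + g i) s = csum f s + csum g s.
Proof. induction s as [|a s IH]; simpl; [|rewrite IH]; ring. Qed.

Lemma csum_scal {I} (c : C) (f : I -> C) s :
  csum (fun i => c * f i) s = c * csum f s.
Proof. induction s as [|a s IH]; simpl; [|rewrite IH]; ring. Qed.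

Lemma csum_RtoC {I} (p : I -> R) s : csum (fun i => RtoC (p i)) s = RtoC (rsum p s).
Proof. induction s as [|a s IH]; simpl; [|rewrite IH, RtoC_plus]; reflexivity. Qed.

Lemma rsum_scal {I} (c : R) (p : I -> R) s :
  rsum (fun i => c * p i)%R s = (c * rsum p s)%R.
Proof. induction s as [|a s IH]; simpl; [|rewrite IH]; ring. Qed.

Lemma rsum_le {I} (p r : I -> R) s :
  (forall i, p i <= r i)%R -> (rsum p s <= rsum r s)%R.
Proof.
  intros H; induction s as [|a s IH]; simpl; [lra|]. generalize (H a); lra.
Qed.

Lemma rsum_ge0 {I} (p : I -> R) s : (forall i, 0 <= p i)%R -> (0 <= rsum p s)%R.
Proof.
  intros H; induction s as [|a s IH]; simpl; [lra|]. generalize (H a); lra.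
Qed.

(** The terms of s are removed one by one from t; this is where repetition-free
    lists are needed. *)
Lemma rsum_incl {I} (p : I -> R) s t :
  (forall i, 0 <= p i)%R -> NoDup s -> incl s t -> (rsum p s <= rsum p t)%R.
Proof.
  intros Hp. revert t; induction s as [|a s IH]; intros t Hs Hst.
  - apply rsum_ge0; exact Hp.
  - inversion Hs as [|a' s' Ha Hs']; subst.
    destruct (in_split a t) as [t1 [t2 ->]]; [apply Hst; left; reflexivity|].
    rewrite (rsum_perm p (t1 ++ a :: t2) (a :: t1 ++ t2))
      by (symmetry; apply Permutation_middle).
    simpl. apply Rplus_le_compat_l, IH; [exact Hs'|].
    intros i Hi. assert (Hit : In i (t1 ++ a :: t2)) by (apply Hst; right; exact Hi).
    apply in_app_iff in Hit; apply in_app_iff.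
    destruct Hit as [H|[H|H]]; [tauto| |tauto]. subst i; contradiction.
Qed.

Lemma exists_nodup {I} (s : list I) : exists t, NoDup t /\ forall i, In i t <-> In i s.
Proof.
  pose (dec := fun a b : I => excluded_middle_informative (a = b)).
  exists (nodup dec s); split; [apply NoDup_nodup|intros i; apply nodup_In].
Qed.

Lemma has_sum_unique {I} (f : I -> C) l l' : has_sum f l -> has_sum f l' -> l = l'.
Proof.
  intros H H'. apply Ceq_minus, Cmod_eq_0.
  destruct (Rle_lt_dec (Cmod (l - l')) 0) as [|Hpos].
  { apply Rle_antisym; [assumption|apply Cmod_ge_0]. }
  destruct (H (Cmod (l - l') / 2)%R) as [s Hs]; [lra|].
  destruct (H' (Cmod (l - l') / 2)%R) as [s' Hs']; [lra|].
  destruct (exists_nodup (s ++ s')) as [t [Ht Hin]].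
  specialize (Hs t Ht). specialize (Hs' t Ht).
  assert (H1 : (Cmod (csum f t - l) < Cmod (l - l') / 2)%R).
  { apply Hs. intros i Hi; apply Hin, in_app_iff; tauto. }
  assert (H2 : (Cmod (csum f t - l') < Cmod (l - l') / 2)%R).
  { apply Hs'. intros i Hi; apply Hin, in_app_iff; tauto. }
  assert (H3 : (Cmod (l - l') <= Cmod (csum f t - l') + Cmod (csum f t - l))%R).
  { replace (l - l') with ((csum f t - l') + - (csum f t - l)) by ring.
    eapply Rle_trans; [apply Cmod_triangle|]. rewrite Cmod_opp; lra. }
  lra.
Qed.

Lemma has_sum_ext {I} (f g : I -> C) l :
  (forall i, f i = g i) -> has_sum f l -> has_sum g l.
Proof.
  intros E H eps He. destruct (H eps He) as [s0 Hs]. exists s0; intros s H1 H2.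
  rewrite <- (csum_ext f g s) by (intros; apply E). apply Hs; assumption.
Qed.

Lemma has_sum_plus {I} (f g : I -> C) l m :
  has_sum f l -> has_sum g m -> has_sum (fun i => f i + g i) (l + m).
Proof.
  intros Hf Hg eps He.
  destruct (Hf (eps / 2)%R) as [s Hs]; [lra|].
  destruct (Hg (eps / 2)%R) as [t Ht]; [lra|].
  exists (s ++ t). intros u Hu Hin. rewrite csum_plus.
  replace (csum f u + csum g u - (l + m)) with ((csum f u - l) + (csum g u - m)) by ring.
  assert (Cmod (csum f u - l) < eps / 2)%R
    by (apply Hs; [assumption|intros i Hi; apply Hin, in_app_iff; tauto]).
  assert (Cmod (csum g u - m) < eps / 2)%R
    by (apply Ht; [assumption|intros i Hi; apply Hin, in_app_iff; tauto]).
  eapply Rle_lt_trans; [apply Cmod_triangle|]. lra.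
Qed.

Lemma has_sum_scal {I} (c : C) (f : I -> C) l :
  has_sum f l -> has_sum (fun i => c * f i) (c * l).
Proof.
  intros Hf eps He.
  assert (Hc := Cmod_ge_0 c).
  destruct (Hf (eps / (Cmod c + 1))%R) as [s Hs].
  { apply Rdiv_lt_0_compat; lra. }
  exists s. intros u Hu Hin. rewrite csum_scal.
  replace (c * csum f u - c * l) with (c * (csum f u - l)) by ring.
  rewrite Cmod_mult. specialize (Hs u Hu Hin).
  assert (Hlt : (Cmod (csum f u - l) * (Cmod c + 1) < eps)%R).
  { apply (Rmult_lt_compat_r (Cmod c + 1)) in Hs; [|lra].
    unfold Rdiv in Hs. rewrite Rmult_assoc, Rinv_l, Rmult_1_r in Hs; lra. }
  generalize (Cmod_ge_0 (csum f u - l)); nra.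
Qed.

Lemma has_sum_finite {I} (f : I -> C) (s0 : list I) :
  NoDup s0 -> (forall i, ~ In i s0 -> f i = 0) -> has_sum f (csum f s0).
Proof.
  intros Hs0 Hf eps He. exists s0. intros s Hs Hin.
  replace (csum f s) with (csum f s0); [replace (_ - _) with (RtoC 0) by ring;
    rewrite Cmod_0; exact He|].
  revert s Hs Hin. clear He eps.
  induction s0 as [|a s0 IH] in f, Hs0, Hf |- *; intros s Hs Hin.
  - clear -Hf. induction s as [|b s IHs]; simpl; [reflexivity|].
    rewrite <- IHs, Hf by (intros []). simpl; ring.
  - destruct (in_split a s) as [t1 [t2 ->]]; [apply Hin; left; reflexivity|].
    rewrite (csum_perm f (t1 ++ a :: t2) (a :: t1 ++ t2))
      by (symmetry; apply Permutation_middle).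
    apply (Permutation_NoDup (l' := a :: t1 ++ t2)) in Hs;
      [|symmetry; apply Permutation_middle].
    inversion Hs as [|a' s' Ha Hs']; subst.
    inversion Hs0 as [|a' s' Ha0 Hs0']; subst.
    simpl. f_equal.
    pose (g := fun i => if excluded_middle_informative (i = a) then RtoC 0 else f i).
    assert (Eg : forall t, ~ In a t -> csum f t = csum g t).
    { intros t Hat. apply csum_ext. intros i Hi. unfold g.
      destruct (excluded_middle_informative (i = a)); [subst; contradiction|reflexivity]. }
    rewrite (Eg s0 Ha0), (Eg _ Ha). apply IH; [exact Hs0'| |exact Hs'|].
    + intros i Hi. unfold g.
      destruct (excluded_middle_informative (i = a)) as [|Hne]; [reflexivity|].
      apply Hf. intros [E|E]; [apply Hne; symmetry; exact E|contradiction].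
    + intros i Hi. assert (Hit : In i (t1 ++ a :: t2)) by (apply Hin; right; exact Hi).
      apply in_app_iff in Hit; apply in_app_iff.
      destruct Hit as [H|[H|H]]; [tauto| |tauto]. subst i; contradiction.
Qed.

Lemma summable_le {I} (p r : I -> R) :
  (forall i, p i <= r i)%R -> summable r -> summable p.
Proof.
  intros H [B HB]. exists B. intros s Hs.
  eapply Rle_trans; [apply rsum_le, H|apply HB, Hs].
Qed.

Lemma summable_scal {I} (c : R) (p : I -> R) :
  (0 <= c)%R -> summable p -> summable (fun i => c * p i)%R.
Proof.
  intros Hc [B HB]. exists (c * B)%R. intros s Hs. rewrite rsum_scal.
  apply Rmult_le_compat_l; [exact Hc|apply HB, Hs].
Qed.

Lemma summable_comp {I J} (phi : I -> J) (p : J -> R) :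
  (forall i i', phi i = phi i' -> i = i') ->
  summable p -> summable (fun i => p (phi i)).
Proof.
  intros Hinj [B HB]. exists B. intros s Hs. rewrite <- rsum_map.
  apply HB, FinFun.Injective_map_NoDup; [exact Hinj|exact Hs].
Qed.

(** The sum is the supremum of the finite partial sums. *)
Lemma has_sum_nonneg {I} (p : I -> R) :
  (forall i, 0 <= p i)%R -> summable p -> exists l, has_sum (fun i => RtoC (p i)) l.
Proof.
  intros Hp [B HB].
  destruct (completeness (fun v => exists s, NoDup s /\ v = rsum p s)) as [l [Hub Hlub]].
  - exists B. intros v [s [Hs ->]]. apply HB, Hs.
  - exists 0%R, []. split; [constructor|reflexivity].
  - exists (RtoC l). intros eps He.
    assert (Hex : exists s, NoDup s /\ (l - eps < rsum p s)%R).
    { apply NNPP. intros Hn. assert (l <= l - eps)%R; [|lra].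
      apply Hlub. intros v [s [Hs ->]]. apply Rnot_lt_le. intros Hlt.
      apply Hn. exists s; split; assumption. }
    destruct Hex as [s0 [Hs0 Hlt]]. exists s0. intros s Hs Hin.
    rewrite csum_RtoC, <- RtoC_minus, Cmod_R.
    assert (rsum p s <= l)%R by (apply Hub; exists s; split; [assumption|reflexivity]).
    assert (rsum p s0 <= rsum p s)%R by (apply rsum_incl; assumption).
    apply Rabs_def1; lra.
Qed.

(** Absolute convergence implies convergence: |u| + u and |u| are nonnegative
    families for u the real or the imaginary part of f. *)
Lemma summable_has_sum {I} (f : I -> C) :
  summable (fun i => Cmod (f i)) -> exists l, has_sum f l.
Proof.
  intros H.
  assert (Hreal : forall u : I -> R, (forall i, Rabs (u i) <= Cmod (f i))%R ->
    exists l, has_sum (fun i => RtoC (u i)) l).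
  { intros u Hu.
    destruct (has_sum_nonneg (fun i => Rabs (u i) + u i)%R) as [l1 H1].
    { intros i; generalize (Rle_abs (- u i)); rewrite Rabs_Ropp; lra. }
    { apply summable_le with (fun i => 2 * Cmod (f i))%R.
      - intros i; generalize (Rle_abs (u i)) (Hu i); lra.
      - apply summable_scal; [lra|exact H]. }
    destruct (has_sum_nonneg (fun i => Rabs (u i))) as [l2 H2].
    { intros i; apply Rabs_pos. }
    { apply summable_le with (2 := H); exact Hu. }
    exists (l1 + - (1) * l2).
    apply has_sum_ext with (2 := has_sum_plus _ _ _ _ H1 (has_sum_scal _ _ _ H2)).
    intros i. simpl. rewrite RtoC_plus. ring. }
  destruct (Hreal (fun i => Re (f i))) as [a Ha]; [intros i; apply re_le_Cmod|].
  destruct (Hreal (fun i => Im (f i))) as [b Hb].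
  { intros i; eapply Rle_trans; [|apply Rmax_Cmod]. apply Rmax_r. }
  exists (a + Ci * b).
  apply has_sum_ext with (2 := has_sum_plus _ _ _ _ Ha (has_sum_scal _ _ _ Hb)).
  intros i. simpl. destruct (f i) as [u v]. unfold Ci, RtoC, Cplus, Cmult; simpl.
  f_equal; ring.
Qed.

(** A finite set of indices splits into the image of a finite set and a rest
    outside the range of phi; this reduces sums over the target of an injection
    to sums over its source. *)
Lemma list_range {A B} (phi : A -> B) (s : list B) :
  (forall a a', phi a = phi a' -> a = a') -> NoDup s ->
  exists s' r, NoDup s' /\ Permutation s (map phi s' ++ r) /\
    forall b, In b r -> forall a, phi a <> b.
Proof.
  intros Hinj. induction s as [|b s IH]; intros Hs.
  - exists [], []. repeat split; [constructor|constructor|intros b []].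
  - inversion Hs as [|b' s' Hb Hs']; subst.
    destruct (IH Hs') as (s' & r & H1 & H2 & H3).
    destruct (excluded_middle_informative (exists a, phi a = b)) as [[a <-]|Hn].
    + exists (a :: s'), r. repeat split; [|simpl; constructor; exact H2|exact H3].
      constructor; [|exact H1]. intros Ha. apply Hb.
      apply (Permutation_in _ (Permutation_sym H2)), in_app_iff. left.
      apply in_map; exact Ha.
    + exists s', (b :: r). repeat split; [exact H1| |].
      * apply Permutation_cons_app; exact H2.
      * intros b' [<-|Hb'] a E; [apply Hn; exists a; exact E|exact (H3 b' Hb' a E)].
Qed.

Lemma csum_zero {I} (f : I -> C) s : (forall i, In i s -> f i = 0) -> csum f s = 0.
Proof.
  induction s as [|a s IH]; intros H; simpl; [reflexivity|].
  rewrite H by (left; reflexivity). rewrite IH; [ring|].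
  intros i Hi; apply H; right; exact Hi.
Qed.

Lemma rsum_zero {I} (f : I -> R) s : (forall i, In i s -> f i = 0%R) -> rsum f s = 0%R.
Proof.
  induction s as [|a s IH]; intros H; simpl; [reflexivity|].
  rewrite H by (left; reflexivity). rewrite IH; [ring|].
  intros i Hi; apply H; right; exact Hi.
Qed.

(** Reindexing along an injection whose range supports f.  It also covers
    bijective changes of summation variables. *)
Lemma has_sum_extend {A B} (phi : A -> B) (f : B -> C) l :
  (forall a a', phi a = phi a' -> a = a') ->
  (forall b, (forall a, phi a <> b) -> f b = 0) ->
  has_sum (fun a => f (phi a)) l -> has_sum f l.
Proof.
  intros Hinj H0 H eps He. destruct (H eps He) as [s0 Hs0].
  exists (map phi s0). intros s Hs Hin.
  destruct (list_range phi s Hinj Hs) as (s' & r & H1 & H2 & H3).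
  rewrite (csum_perm _ _ _ H2), csum_app, csum_map, (csum_zero f r).
  - rewrite Cplus_0_r. apply Hs0; [exact H1|].
    intros a Ha. assert (Hp : In (phi a) s) by (apply Hin, in_map, Ha).
    apply (Permutation_in _ H2), in_app_iff in Hp. destruct Hp as [Hp|Hp].
    + apply in_map_iff in Hp. destruct Hp as [a' [E Ha']].
      apply Hinj in E; subst; exact Ha'.
    + exfalso; exact (H3 _ Hp a eq_refl).
  - intros b Hb; apply H0; exact (H3 b Hb).
Qed.

Lemma summable_extend {A B} (phi : A -> B) (p : B -> R) :
  (forall a a', phi a = phi a' -> a = a') ->
  (forall b, (forall a, phi a <> b) -> p b = 0%R) ->
  summable (fun a => p (phi a)) -> summable p.
Proof.
  intros Hinj H0 [M HM]. exists M. intros s Hs.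
  destruct (list_range phi s Hinj Hs) as (s' & r & H1 & H2 & H3).
  rewrite (rsum_perm _ _ _ H2), rsum_app, rsum_map, (rsum_zero p r).
  - rewrite Rplus_0_r. apply HM; exact H1.
  - intros b Hb; apply H0; exact (H3 b Hb).
Qed.

(** * Iterated and product sums *)

(** Only convergence of the total sum and of each inner sum is used: a finite
    set K of outer indices is completed to a finite set of pairs, over
    every a in K by a finite set on which the inner sum is within eta of
    its value. *)
Lemma has_sum_fubini {A B} (f : A -> B -> C) (g : A -> C) l :
  has_sum (fun p => f (fst p) (snd p)) l ->
  (forall a, has_sum (f a) (g a)) -> has_sum g l.
Proof.
  intros H Hg.
  assert (Hbuild : forall (t0 : list B) (eta : R), (0 < eta)%R ->
    forall K : list A, NoDup K -> exists G : list (A * B), NoDup G /\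
      (forall a b, In (a, b) G -> In a K) /\
      (forall a b, In a K -> In b t0 -> In (a, b) G) /\
      (Cmod (csum g K - csum (fun p => f (fst p) (snd p)) G)
         <= INR (length K) * eta)%R).
  { intros t0 eta Heta. induction K as [|a K IH]; intros HK.
    - exists []. repeat split; [constructor|intros a b []|intros a b []|].
      simpl. replace (0 - 0) with (RtoC 0) by ring. rewrite Cmod_0; lra.
    - inversion HK as [|a' K' Ha HK']; subst.
      destruct (IH HK') as (G & G1 & G2 & G3 & G4).
      destruct (Hg a eta Heta) as [s0 Hs0].
      destruct (exists_nodup (s0 ++ t0)) as [t [Ht Htin]].
      exists (map (fun b => (a, b)) t ++ G). repeat split.
      + apply NoDup_app; [|exact G1|].
        * apply FinFun.Injective_map_NoDup; [|exact Ht].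
          intros b b' E; inversion E; reflexivity.
        * intros [a' b] Hin Hin'. apply in_map_iff in Hin.
          destruct Hin as [b' [E _]]. inversion E; subst.
          exact (Ha (G2 _ _ Hin')).
      + intros a' b Hin. apply in_app_iff in Hin. destruct Hin as [Hin|Hin].
        * apply in_map_iff in Hin. destruct Hin as [b' [E _]].
          inversion E; left; reflexivity.
        * right; exact (G2 _ _ Hin).
      + intros a' b [<-|Ha'] Hb; apply in_app_iff.
        * left. apply in_map_iff. exists b; split; [reflexivity|].
          apply Htin, in_app_iff; right; exact Hb.
        * right; apply G3; assumption.
      + rewrite csum_app, csum_map. cbn [csum fold_right fst snd length].
        fold (csum g K). rewrite S_INR.
        change (fun i => f a i) with (f a).
        replace (g a + csum g K - _) with
          (- (csum (f a) t - g a) + (csum g K - csum (fun p => f (fst p) (snd p)) G)) by ring.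
        eapply Rle_trans; [apply Cmod_triangle|]. rewrite Cmod_opp.
        assert (Cmod (csum (f a) t - g a) < eta)%R.
        { apply Hs0; [exact Ht|]. intros b Hb; apply Htin, in_app_iff; left; exact Hb. }
        lra. }
  intros eps He. destruct (H (eps / 2)%R) as [F HF]; [lra|].
  exists (map fst F). intros K HK Hin.
  assert (HlK : (0 < INR (length K) + 1)%R) by (generalize (pos_INR (length K)); lra).
  destruct (Hbuild (map snd F) (eps / 2 / (INR (length K) + 1))%R) with (K := K)
    as (G & G1 & G2 & G3 & G4); [apply Rdiv_lt_0_compat; lra|exact HK|].
  assert (HG : (Cmod (csum (fun p => f (fst p) (snd p)) G - l) < eps / 2)%R).
  { apply HF; [exact G1|]. intros [a b] Hab. apply G3.
    - apply Hin. apply (in_map fst) in Hab; exact Hab.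
    - apply (in_map snd) in Hab; exact Hab. }
  replace (csum g K - l) with
    ((csum g K - csum (fun p => f (fst p) (snd p)) G) +
     (csum (fun p => f (fst p) (snd p)) G - l)) by ring.
  eapply Rle_lt_trans; [apply Cmod_triangle|].
  assert (INR (length K) * (eps / 2 / (INR (length K) + 1)) <= eps / 2)%R; [|lra].
  set (w := INR (length K)) in *.
  replace (w * (eps / 2 / (w + 1)))%R with (eps / 2 * (w / (w + 1)))%R by (field; lra).
  rewrite <- (Rmult_1_r (eps / 2)) at 2. apply Rmult_le_compat_l; [lra|].
  apply Rmult_le_reg_r with (w + 1)%R; [lra|].
  unfold Rdiv. rewrite Rmult_assoc, Rinv_l; lra.
Qed.

Lemma summable_prod {A B} (p : A -> R) (r : B -> R) :
  (forall a, 0 <= p a)%R -> (forall b, 0 <= r b)%R ->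
  summable p -> summable r -> summable (fun u => p (fst u) * r (snd u))%R.
Proof.
  intros Hp Hr [M HM] [N HN]. exists (M * N)%R. intros s Hs.
  destruct (exists_nodup (map fst s)) as [sa [Hsa Ha]].
  destruct (exists_nodup (map snd s)) as [sb [Hsb Hb]].
  apply Rle_trans with (rsum (fun u => p (fst u) * r (snd u))%R (list_prod sa sb)).
  - apply rsum_incl; [|exact Hs|].
    + intros u; apply Rmult_le_pos; auto.
    + intros [a b] Hab. apply in_prod.
      * apply Ha. apply (in_map fst) in Hab; exact Hab.
      * apply Hb. apply (in_map snd) in Hab; exact Hab.
  - replace (rsum _ (list_prod sa sb)) with (rsum p sa * rsum r sb)%R.
    + apply Rmult_le_compat; auto using rsum_ge0.
    + clear. induction sa as [|a sa IH]; simpl; [ring|].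
      rewrite rsum_app, rsum_map, <- IH. simpl. rewrite rsum_scal. ring.
Qed.

Lemma has_sum_prod {A B} (f : A -> C) (g : B -> C) a b :
  summable (fun i => Cmod (f i)) -> summable (fun i => Cmod (g i)) ->
  has_sum f a -> has_sum g b ->
  has_sum (fun u => f (fst u) * g (snd u)) (a * b).
Proof.
  intros Sf Sg Hf Hg.
  destruct (summable_has_sum (fun u => f (fst u) * g (snd u))) as [l Hl].
  { apply summable_le with (fun u => Cmod (f (fst u)) * Cmod (g (snd u)))%R.
    - intros u; rewrite Cmod_mult; lra.
    - apply (summable_prod (fun i => Cmod (f i)) (fun i => Cmod (g i)));
        auto using Cmod_ge_0. }
  assert (H1 : has_sum (fun i => f i * b) l).
  { apply (has_sum_fubini (fun i j => f i * g j)); [exact Hl|].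
    intros i. exact (has_sum_scal (f i) _ _ Hg). }
  assert (E : l = b * a).
  { apply (has_sum_unique _ _ _ H1).
    apply has_sum_ext with (2 := has_sum_scal b _ _ Hf). intros i; ring. }
  replace (a * b) with l; [exact Hl|rewrite E; ring].
Qed.

(** * Limits of complex sequences, series and bilateral series *)

Definition Cconv (u : nat -> C) (l : C) : Prop :=
  forall eps : R, (0 < eps)%R ->
  exists N : nat, forall n, (N <= n)%nat -> (Cmod (u n - l) < eps)%R.

Lemma Cconv_filterlim (u : nat -> C) (l : C) :
  Cconv u l -> filterlim u eventually (locally l).
Proof.
  intros H. apply (filterlim_locally_ball_norm (K := C_AbsRing) (U := C_NormedModule)).
  intros eps. destruct (H eps (cond_pos eps)) as [N HN].
  exists N. intros n Hn. exact (HN n Hn).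
Qed.

Lemma filterlim_C_unique (u : nat -> C) (l m : C) :
  filterlim u eventually (locally l) -> filterlim u eventually (locally m) -> l = m.
Proof.
  exact (filterlim_locally_unique (K := C_AbsRing) (V := C_NormedModule)
           (F := eventually) u l m).
Qed.

(** Limits are unique in C, so the unique-choice operator returns the limit. *)
Lemma Cconv_lim (u : nat -> C) (l : C) : Cconv u l -> Clim_seq u = l.
Proof.
  intros H%Cconv_filterlim. unfold Clim_seq. apply (iota_unique (V := C_CompleteNormedModule)); [|exact H].
  intros m Hm. exact (filterlim_C_unique u m l Hm H).
Qed.

Lemma Cconv_unique (u : nat -> C) (l m : C) : Cconv u l -> Cconv u m -> l = m.
Proof. intros H1%Cconv_lim H2%Cconv_lim; congruence. Qed.

Lemma Cconv_ext (u v : nat -> C) (l : C) : (forall n, u n = v n) -> Cconv u l -> Cconv v l.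
Proof.
  intros E H eps He. destruct (H eps He) as [N HN]. exists N; intros n Hn.
  rewrite <- E; apply HN, Hn.
Qed.

Lemma Cconv_const (c : C) : Cconv (fun _ => c) c.
Proof.
  intros eps He. exists 0%nat. intros n _.
  replace (c - c) with (RtoC 0) by ring. rewrite Cmod_0; exact He.
Qed.

Lemma Cconv_shift (u : nat -> C) (l : C) : Cconv u l -> Cconv (fun n => u (S n)) l.
Proof.
  intros H eps He. destruct (H eps He) as [N HN]. exists N; intros n Hn. apply HN; lia.
Qed.

Lemma Cconv_plus (u v : nat -> C) (l m : C) :
  Cconv u l -> Cconv v m -> Cconv (fun n => u n + v n) (l + m).
Proof.
  intros Hu Hv eps He.
  destruct (Hu (eps / 2)%R) as [N HN]; [lra|].
  destruct (Hv (eps / 2)%R) as [M HM]; [lra|].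
  exists (N + M)%nat. intros n Hn.
  specialize (HN n ltac:(lia)). specialize (HM n ltac:(lia)).
  replace (u n + v n - (l + m)) with ((u n - l) + (v n - m)) by ring.
  eapply Rle_lt_trans; [apply Cmod_triangle|]. lra.
Qed.

Lemma Cconv_mult (u v : nat -> C) (l m : C) :
  Cconv u l -> Cconv v m -> Cconv (fun n => u n * v n) (l * m).
Proof.
  intros Hu Hv eps He.
  assert (Hm := Cmod_ge_0 m). assert (Hl := Cmod_ge_0 l).
  set (K := (Cmod l + Cmod m + 1)%R).
  set (e := Rmin 1 (eps / (2 * K))).
  assert (HK : (0 < eps / (2 * K))%R) by (apply Rdiv_lt_0_compat; unfold K; lra).
  assert (He0 : (0 < e)%R) by (unfold e; apply Rmin_glb_lt; lra).
  assert (He1 : (e <= 1)%R) by apply Rmin_l.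
  assert (HeK : (e * K <= eps / 2)%R).
  { replace (eps / 2)%R with (eps / (2 * K) * K)%R by (field; unfold K; lra).
    apply Rmult_le_compat_r; [unfold K; lra|apply Rmin_r]. }
  destruct (Hu e He0) as [N HN]. destruct (Hv e He0) as [M HM].
  exists (N + M)%nat. intros n Hn.
  specialize (HN n ltac:(lia)). specialize (HM n ltac:(lia)).
  replace (u n * v n - l * m) with ((u n - l) * (v n - m) + (l * (v n - m) + m * (u n - l)))
    by ring.
  eapply Rle_lt_trans; [apply Cmod_triangle|].
  eapply Rle_lt_trans; [apply Rplus_le_compat_l, Cmod_triangle|].
  rewrite !Cmod_mult.
  generalize (Cmod_ge_0 (u n - l)) (Cmod_ge_0 (v n - m)). unfold K in HeK. nra.
Qed.

Lemma Cconv_Cmod_le (u : nat -> C) (l : C) (B : R) :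
  (forall n, Cmod (u n) <= B)%R -> Cconv u l -> (Cmod l <= B)%R.
Proof.
  intros HB H. apply Rnot_lt_le. intros Hlt.
  destruct (H (Cmod l - B)%R) as [N HN]; [lra|].
  specialize (HN N (le_n N)). specialize (HB N).
  assert (Cmod l <= Cmod (u N) + Cmod (u N - l))%R; [|lra].
  replace l with (u N + - (u N - l)) at 1 by ring.
  eapply Rle_trans; [apply Cmod_triangle|]. rewrite Cmod_opp; lra.
Qed.

Lemma Cconv_Cmod_ge (u : nat -> C) (l : C) (B : R) :
  (forall n, B <= Cmod (u n))%R -> Cconv u l -> (B <= Cmod l)%R.
Proof.
  intros HB H. apply Rnot_lt_le. intros Hlt.
  destruct (H (B - Cmod l)%R) as [N HN]; [lra|].
  specialize (HN N (le_n N)). specialize (HB N).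
  assert (Cmod (u N) <= Cmod l + Cmod (u N - l))%R; [|lra].
  replace (u N) with (l + (u N - l)) at 1 by ring. apply Cmod_triangle.
Qed.

Lemma has_sum_Cconv (f : nat -> C) (l : C) :
  has_sum f l -> Cconv (fun n => csum f (seq 0 n)) l.
Proof.
  intros H eps He. destruct (H eps He) as [s0 Hs0].
  exists (S (list_max s0)). intros n Hn. apply Hs0; [apply seq_NoDup|].
  intros i Hi. apply in_seq.
  assert (i <= list_max s0)%nat; [|lia].
  assert (Hall := proj1 (list_max_le s0 _) (le_n _)).
  rewrite Forall_forall in Hall. apply Hall, Hi.
Qed.

Lemma sum_n_csum (f : nat -> C) (n : nat) :
  sum_n (G := C_AbelianMonoid) f n = csum f (seq 0 (S n)).
Proof.
  induction n as [|n IH].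
  - rewrite sum_O. simpl. ring.
  - rewrite sum_Sn, IH, (seq_S (S n)), csum_app. simpl. unfold plus; simpl. ring.
Qed.

Lemma has_sum_is_series (f : nat -> C) (l : C) : has_sum f l -> is_series f l.
Proof.
  intros H. apply Cconv_filterlim.
  apply Cconv_ext with (2 := Cconv_shift _ _ (has_sum_Cconv f l H)).
  intros n. symmetry. apply sum_n_csum.
Qed.

Lemma has_sum_Cseries (f : nat -> C) (l : C) : has_sum f l -> Cseries f = l.
Proof.
  intros H%has_sum_is_series. unfold Cseries. apply (iota_unique (V := C_CompleteNormedModule)); [|exact H].
  intros m Hm. exact (filterlim_C_unique _ m l Hm H).
Qed.

Lemma has_sum_incr_1 (f : nat -> C) (l : C) :
  has_sum (fun n => f (S n)) l -> has_sum f (f 0%nat + l).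
Proof.
  intros H.
  pose (f0 := fun n => match n with O => f O | S _ => RtoC 0 end).
  pose (f1 := fun n => match n with O => RtoC 0 | S m => f (S m) end).
  apply has_sum_ext with (fun n => f0 n + f1 n).
  { intros [|n]; unfold f0, f1; ring. }
  apply has_sum_plus.
  - replace (f 0%nat) with (csum f0 [0%nat]) by (unfold f0; simpl; ring).
    apply has_sum_finite.
    + repeat constructor; intros [].
    + intros [|n] Hn; [exfalso; apply Hn; left; reflexivity|reflexivity].
  - apply has_sum_extend with (phi := S); [intros; lia| |exact H].
    intros [|n] Hn; [reflexivity|]. exfalso; exact (Hn n eq_refl).
Qed.

(** The one-sided series are the sums of the restrictions of f to the
    nonnegative and to the negative integers, extended by zero. *)
Lemma has_sum_biseries (f : Z -> C) (l l1 l2 : C) :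
  has_sum f l ->
  has_sum (fun n => f (Z.of_nat n)) l1 ->
  has_sum (fun n => f (- Z.of_nat (S n))%Z) l2 ->
  is_biseries f l.
Proof.
  intros H H1 H2. exists l1, l2.
  split; [exact (has_sum_is_series _ _ H1)|].
  split; [exact (has_sum_is_series _ _ H2)|].
  apply (has_sum_unique f); [exact H|].
  pose (fp := fun k => if (0 <=? k)%Z then f k else RtoC 0).
  pose (fm := fun k => if (0 <=? k)%Z then RtoC 0 else f k).
  apply has_sum_ext with (fun n => fp n + fm n).
  { intros k; unfold fp, fm; destruct (0 <=? k)%Z; ring. }
  apply has_sum_plus.
  - apply has_sum_extend with (phi := Z.of_nat); [intros; lia| |].
    + intros k Hk. unfold fp. destruct (Z.leb_spec 0 k); [|reflexivity].
      exfalso; apply (Hk (Z.to_nat k)); lia.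
    + apply has_sum_ext with (2 := H1). intros n. unfold fp.
      destruct (Z.leb_spec 0 (Z.of_nat n)); [reflexivity|lia].
  - apply has_sum_extend with (phi := fun n => (- Z.of_nat (S n))%Z); [intros; lia| |].
    + intros k Hk. unfold fm. destruct (Z.leb_spec 0 k); [reflexivity|].
      exfalso; apply (Hk (Z.to_nat (- k - 1))); lia.
    + apply has_sum_ext with (2 := H2). intros n. unfold fm.
      destruct (Z.leb_spec 0 (- Z.of_nat (S n))); [lia|reflexivity].
Qed.

(** Absolute convergence of the whole family passes to the restrictions to
    nonnegative and to negative k, which makes both one-sided series of g
    converge. *)
Lemma is_biseries_fubini {B : Type} (F : Z -> B -> C) (g : Z -> C) (l : C) :
  summable (fun u : Z * B => Cmod (F (fst u) (snd u))) ->
  has_sum (fun u : Z * B => F (fst u) (snd u)) l ->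
  (forall k, has_sum (F k) (g k)) -> is_biseries g l.
Proof.
  intros HS Hl Hg.
  assert (Hhalf : forall phi : nat -> Z, (forall n n', phi n = phi n' -> n = n') ->
    exists l', has_sum (fun n => g (phi n)) l').
  { intros phi Hphi.
    destruct (summable_has_sum (fun u : nat * B => F (phi (fst u)) (snd u))) as [l' Hl'].
    { apply (summable_comp (fun u : nat * B => (phi (fst u), snd u))
               (fun v : Z * B => Cmod (F (fst v) (snd v)))); [|exact HS].
      intros [n b] [n' b'] E. cbn [fst snd] in E. inversion E as [[E1 E2]].
      apply Hphi in E1. subst. reflexivity. }
    exists l'. apply (has_sum_fubini (fun n => F (phi n))); [exact Hl'|].
    intros n; apply Hg. }
  destruct (Hhalf Z.of_nat) as [l1 H1]; [intros; lia|].
  destruct (Hhalf (fun n => - Z.of_nat (S n))%Z) as [l2 H2]; [intros; lia|].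
  apply has_sum_biseries with l1 l2; [|exact H1|exact H2].
  exact (has_sum_fubini F g l Hl Hg).
Qed.

(** * Geometric majorants *)

Lemma summable_nat (p : nat -> R) (B : R) :
  (forall n, 0 <= p n)%R -> (forall n, rsum p (seq 0 n) <= B)%R -> summable p.
Proof.
  intros Hp HB. exists B. intros s Hs.
  apply Rle_trans with (2 := HB (S (list_max s))).
  apply rsum_incl; [exact Hp|exact Hs|].
  intros i Hi. apply in_seq.
  assert (Hall := proj1 (list_max_le s _) (le_n _)).
  rewrite Forall_forall in Hall. specialize (Hall i Hi). lia.
Qed.

Lemma rsum_geom (d : R) (n : nat) :
  (0 <= d < 1)%R -> (rsum (fun k => d ^ k) (seq 0 n) <= / (1 - d))%R.
Proof.
  intros Hd.
  assert (E : (rsum (fun k => d ^ k) (seq 0 n) = (1 - d ^ n) / (1 - d))%R).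
  { induction n as [|n IH]; [simpl; field; lra|].
    rewrite seq_S, rsum_app, IH. simpl. field; lra. }
  rewrite E. unfold Rdiv. rewrite <- (Rmult_1_l (/ (1 - d))) at 2.
  apply Rmult_le_compat_r; [left; apply Rinv_0_lt_compat; lra|].
  generalize (pow_le d n (proj1 Hd)); lra.
Qed.

Lemma summable_geom (d : R) : (0 <= d < 1)%R -> summable (fun k => d ^ k)%R.
Proof.
  intros Hd. apply summable_nat with (/ (1 - d))%R.
  - intros n; apply pow_le, Hd.
  - intros n; apply rsum_geom, Hd.
Qed.

(** * q-shifted factorials *)

Lemma exp_mono (u v : R) : (u <= v)%R -> (exp u <= exp v)%R.
Proof. intros [H| ->]; [left; apply exp_increasing, H|right; reflexivity]. Qed.

Lemma exp_neg_lt1 (c : R) : (c < 0)%R -> (exp c < 1)%R.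
Proof. intros H. rewrite <- exp_0. apply exp_increasing, H. Qed.

Lemma exp_pow (c : R) (n : nat) : (exp (INR n * c) = exp c ^ n)%R.
Proof.
  induction n as [|n IH]; [simpl; rewrite Rmult_0_l; apply exp_0|].
  rewrite S_INR, Rmult_plus_distr_r, exp_plus, IH, Rmult_1_l. simpl. ring.
Qed.

Lemma Cmod_qpow_nat (q : R) (i : nat) : (0 < q)%R -> Cmod (RtoC q ^ i) = (q ^ i)%R.
Proof. intros Hq. rewrite Cmod_pow, Cmod_R, Rabs_pos_eq; [reflexivity|lra]. Qed.

(** Since |1 - a q^i| <= 1 + |a| q^i <= exp (|a| q^i), the geometric series in
    the exponent gives a bound independent of k. *)
Lemma qpoch_bound (q : R) (a : C) (k : nat) : (0 < q < 1)%R ->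
  (Cmod (qpoch a q k) <= exp (Cmod a / (1 - q)))%R.
Proof.
  intros Hq.
  assert (H : (Cmod (qpoch a q k) <= exp (Cmod a * rsum (fun i => q ^ i)%R (seq 0 k)))%R).
  { induction k as [|k IH].
    - simpl. rewrite Cmod_1, Rmult_0_r, exp_0; lra.
    - rewrite seq_S, rsum_app. cbn [qpoch rsum fold_right].
      rewrite Cmod_mult, Rplus_0_r, Rmult_plus_distr_l, exp_plus.
      apply Rmult_le_compat; auto using Cmod_ge_0.
      eapply Rle_trans; [apply Cmod_triangle|].
      rewrite Cmod_1, Cmod_opp, Cmod_mult, Cmod_qpow_nat by lra. apply exp_ineq1_le. }
  eapply Rle_trans; [exact H|]. apply exp_mono.
  apply Rmult_le_compat_l; [apply Cmod_ge_0|]. apply rsum_geom; lra.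
Qed.

(** The same estimate for 1/(1 - u) = 1 + u/(1 - u) bounds 1/(q;q)_k from
    above, so that neither (q;q)_k nor its limit vanishes. *)
Lemma qpoch_q_lower (q : R) (k : nat) : (0 < q < 1)%R ->
  (exp (- / (1 - q) ^ 2) <= Cmod (qpoch q q k))%R.
Proof.
  intros Hq.
  assert (H : (exp (- (/ (1 - q) * rsum (fun i => q ^ i)%R (seq 0 k)))
               <= Cmod (qpoch q q k))%R).
  { induction k as [|k IH].
    - simpl. rewrite Cmod_1, Rmult_0_r, Ropp_0, exp_0; lra.
    - rewrite seq_S, rsum_app. cbn [qpoch rsum fold_right].
      rewrite Cmod_mult, Rplus_0_r, Rmult_plus_distr_l, Ropp_plus_distr, exp_plus.
      apply Rmult_le_compat; [left; apply exp_pos|left; apply exp_pos|exact IH|].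
      cbn [Nat.add].
      replace (1 - RtoC q * RtoC q ^ k) with (RtoC (1 - q * q ^ k))
        by (rewrite RtoC_minus, RtoC_mult, RtoC_pow; reflexivity).
      assert (Hp := pow_lt q k (proj1 Hq)).
      assert (Hp1 : (q ^ k <= 1)%R) by (rewrite <- (pow1 k); apply pow_incr; lra).
      rewrite Cmod_R, Rabs_pos_eq by nra.
      (* 1/(1-u) = 1 + u/(1-u) <= exp (q^k/(1-q)) for u = q^(k+1) <= q *)
      rewrite exp_Ropp. set (u := (q * q ^ k)%R).
      assert (Hu : (0 < u <= q)%R) by (unfold u; nra).
      rewrite <- (Rinv_inv (1 - u)).
      apply Rinv_le_contravar; [apply Rinv_0_lt_compat; lra|].
      apply Rle_trans with (1 + / (1 - q) * q ^ k)%R; [|apply exp_ineq1_le].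
      assert (0 < / (1 - q))%R by (apply Rinv_0_lt_compat; lra).
      assert (/ (1 - u) <= / (1 - q))%R by (apply Rinv_le_contravar; lra).
      replace (/ (1 - u))%R with (1 + u * / (1 - u))%R by (field; lra).
      apply Rplus_le_compat_l.
      assert (0 < / (1 - u))%R by (apply Rinv_0_lt_compat; lra).
      assert (u <= q ^ k)%R by (unfold u; nra). nra. }
  eapply Rle_trans; [|exact H]. apply exp_mono, Ropp_le_contravar.
  replace (/ (1 - q) ^ 2)%R with (/ (1 - q) * / (1 - q))%R by (field; lra).
  apply Rmult_le_compat_l; [left; apply Rinv_0_lt_compat; lra|]. apply rsum_geom; lra.
Qed.

Lemma qpoch_q_neq0 (q : R) (k : nat) : (0 < q < 1)%R -> qpoch q q k <> 0.
Proof.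
  intros Hq. apply Cmod_gt_0. eapply Rlt_le_trans; [apply exp_pos|].
  apply qpoch_q_lower, Hq.
Qed.

(** The increments (a;q)_(k+1) - (a;q)_k are dominated by a geometric series. *)
Lemma qpoch_inf_conv (q : R) (a : C) : (0 < q < 1)%R ->
  Cconv (qpoch a q) (qpoch_inf a q).
Proof.
  intros Hq.
  destruct (summable_has_sum (fun k => qpoch a q (S k) - qpoch a q k)) as [l Hl].
  { apply summable_le with (fun k => (exp (Cmod a / (1 - q)) * Cmod a) * q ^ k)%R.
    - intros k. cbn [qpoch].
      replace (qpoch a q k * (1 - a * RtoC q ^ k) - qpoch a q k)
        with (- (qpoch a q k * a * RtoC q ^ k)) by ring.
      rewrite Cmod_opp, !Cmod_mult, Cmod_qpow_nat by lra.
      apply Rmult_le_compat_r; [apply pow_le; lra|].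
      apply Rmult_le_compat_r; [apply Cmod_ge_0|]. apply qpoch_bound, Hq.
    - apply summable_scal; [|apply summable_geom; lra].
      apply Rmult_le_pos; [left; apply exp_pos|apply Cmod_ge_0]. }
  assert (H : Cconv (qpoch a q) (l + 1)).
  { apply Cconv_ext with
      (2 := Cconv_plus _ _ _ _ (has_sum_Cconv _ _ Hl) (Cconv_const 1)).
    intros n. induction n as [|n IH]; [simpl; ring|].
    rewrite seq_S, csum_app. cbn [csum fold_right Nat.add].
    fold (csum (fun k => qpoch a q (S k) - qpoch a q k) (seq 0 n)).
    transitivity (csum (fun k => qpoch a q (S k) - qpoch a q k) (seq 0 n) + 1
                  + (qpoch a q (S n) - qpoch a q n)); [ring|].
    rewrite IH. ring. }
  unfold qpoch_inf. rewrite (Cconv_lim _ _ H). exact H.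
Qed.

Lemma qpoch_Sl (q : R) (a : C) (k : nat) :
  qpoch a q (S k) = (1 - a) * qpoch (a * q) q k.
Proof.
  induction k as [|k IH]; [simpl; ring|].
  cbn [qpoch] in *. rewrite IH. rewrite Cpow_S. ring.
Qed.

Lemma qpoch_inf_step (q : R) (a : C) : (0 < q < 1)%R ->
  qpoch_inf a q = (1 - a) * qpoch_inf (a * q) q.
Proof.
  intros Hq. apply (Cconv_unique (fun k => qpoch a q (S k))).
  - apply Cconv_shift, qpoch_inf_conv, Hq.
  - apply Cconv_ext with
      (2 := Cconv_mult _ _ _ _ (Cconv_const (1 - a)) (qpoch_inf_conv q (a * q) Hq)).
    intros n; symmetry; apply qpoch_Sl.
Qed.

Lemma qpoch_inf_bound (q : R) (a : C) : (0 < q < 1)%R ->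
  (Cmod (qpoch_inf a q) <= exp (Cmod a / (1 - q)))%R.
Proof.
  intros Hq. apply Cconv_Cmod_le with (2 := qpoch_inf_conv q a Hq).
  intros n; apply qpoch_bound, Hq.
Qed.

Lemma qpoch_inf_q_neq0 (q : R) : (0 < q < 1)%R -> qpoch_inf q q <> 0.
Proof.
  intros Hq. apply Cmod_gt_0.
  eapply Rlt_le_trans; [apply exp_pos|].
  apply Cconv_Cmod_ge with (2 := qpoch_inf_conv q q Hq).
  intros n; apply qpoch_q_lower, Hq.
Qed.

Lemma Cinv_qpoch_bound (q : R) (k : nat) : (0 < q < 1)%R ->
  (Cmod (/ qpoch q q k) <= exp (/ (1 - q) ^ 2))%R.
Proof.
  intros Hq. rewrite Cmod_inv by apply (qpoch_q_neq0 q k Hq).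
  rewrite <- (Rinv_inv (exp (/ (1 - q) ^ 2))), <- exp_Ropp.
  apply Rinv_le_contravar; [apply exp_pos|apply qpoch_q_lower, Hq].
Qed.

(** * The q-binomial theorem *)

(** With c_m = (a;q)_m/(q;q)_m, the recurrence
    c_(m+1) (1 - q^(m+1)) = c_m (1 - a q^m) says that F(u) = sum_m c_m u^m satisfies
    (1 - u) F(u) = (1 - a u) F(q u).  Iterating from u = w gives
    (w;q)_k F(w) = (a w;q)_k F(w q^k), and F(w q^k) tends to F(0) = 1.  The
    product form avoids dividing by (w;q)_oo. *)
Lemma q_binomial (q : R) (a w : C) : (0 < q < 1)%R -> (Cmod w < 1)%R ->
  exists F : C,
    has_sum (fun m => qpoch a q m / qpoch q q m * w ^ m) F /\
    qpoch_inf w q * F = qpoch_inf (a * w) q.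
Proof.
  intros Hq Hw.
  set (c := fun m => qpoch a q m / qpoch q q m).
  set (B := (exp (Cmod a / (1 - q)) * exp (/ (1 - q) ^ 2))%R).
  assert (HB0 : (0 <= B)%R) by (apply Rmult_le_pos; left; apply exp_pos).
  assert (HB : forall m, (Cmod (c m) <= B)%R).
  { intros m. unfold c, Cdiv. rewrite Cmod_mult.
    apply Rmult_le_compat; auto using Cmod_ge_0, qpoch_bound, Cinv_qpoch_bound. }
  assert (Sc : forall u, (Cmod u < 1)%R -> summable (fun m => Cmod (c m * u ^ m))).
  { intros u Hu. apply summable_le with (fun m => B * Cmod u ^ m)%R.
    - intros m. rewrite Cmod_mult, Cmod_pow.
      apply Rmult_le_compat_r; [apply pow_le, Cmod_ge_0|apply HB].
    - apply summable_scal; [exact HB0|]. apply summable_geom.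
      split; [apply Cmod_ge_0|exact Hu]. }
  assert (Hex : forall k, exists F, has_sum (fun m => c m * (w * RtoC q ^ k) ^ m) F).
  { intros k. apply summable_has_sum, Sc. rewrite Cmod_mult, Cmod_qpow_nat by lra.
    assert (q ^ k <= 1)%R by (rewrite <- (pow1 k); apply pow_incr; lra).
    assert (0 < q ^ k)%R by (apply pow_lt; lra).
    generalize (Cmod_ge_0 w); nra. }
  destruct (choice _ Hex) as [F HF].
  assert (Hc : forall m, c (S m) * (1 - RtoC q ^ S m) = c m * (1 - a * RtoC q ^ m)).
  { intros m. unfold c. cbn [qpoch].
    assert (H1 := qpoch_q_neq0 q m Hq). assert (H2 := qpoch_q_neq0 q (S m) Hq).
    cbn [qpoch] in H2. rewrite Cpow_S. field. split; [exact H1|].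
    intros E; apply H2; rewrite E; ring. }
  (* F k stands for F(w q^k) *)
  assert (Hfun : forall k,
    (1 - w * RtoC q ^ k) * F k = (1 - a * w * RtoC q ^ k) * F (S k)).
  { intros k. set (u := w * RtoC q ^ k).
    assert (H0 : has_sum (fun m => c m * u ^ m + - (1) * (c m * (w * RtoC q ^ S k) ^ m))
                  (F k + - (1) * F (S k))).
    { apply has_sum_plus; [apply HF|]. apply has_sum_scal, HF. }
    assert (H1 : has_sum (fun m => u * (c m * u ^ m) + - (a * u) * (c m * (w * RtoC q ^ S k) ^ m))
                  (u * F k + - (a * u) * F (S k))).
    { apply has_sum_plus; apply has_sum_scal, HF. }
    assert (E : F k + - (1) * F (S k) = u * F k + - (a * u) * F (S k)).
    { apply (has_sum_unique _ _ _ H0).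
      replace (u * F k + - (a * u) * F (S k)) with
        ((c 0%nat * u ^ 0 + - (1) * (c 0%nat * (w * RtoC q ^ S k) ^ 0))
          + (u * F k + - (a * u) * F (S k))) by (simpl; ring).
      apply (has_sum_incr_1 (fun m => c m * u ^ m + - (1) * (c m * (w * RtoC q ^ S k) ^ m))).
      apply has_sum_ext with (2 := H1). intros m.
      replace (w * RtoC q ^ S k) with (u * q) by (unfold u; rewrite Cpow_S; ring).
      rewrite !Cpow_mult_l.
      transitivity (u ^ S m * (c (S m) * (1 - RtoC q ^ S m))).
      - rewrite Hc, Cpow_S. ring.
      - ring. }
    unfold u in E |- *.
    transitivity (F k + - (1) * F (S k) - w * RtoC q ^ k * F k + F (S k)); [ring|].
    rewrite E. ring. }
  assert (Hiter : forall k, qpoch w q k * F 0%nat = qpoch (a * w) q k * F k).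
  { induction k as [|k IH]; [simpl; ring|]. cbn [qpoch].
    transitivity (qpoch w q k * F 0%nat * (1 - w * RtoC q ^ k)); [ring|].
    rewrite IH.
    transitivity (qpoch (a * w) q k * ((1 - w * RtoC q ^ k) * F k)); [ring|].
    rewrite Hfun. ring. }
  assert (Hlim : Cconv F 1).
  { assert (HFb : forall k, (Cmod (F k - 1) <= B * / (1 - Cmod w) * q ^ k)%R).
    { intros k. set (u := w * RtoC q ^ k).
      assert (Hqk : (0 < q ^ k <= 1)%R).
      { split; [apply pow_lt; lra|]. rewrite <- (pow1 k); apply pow_incr; lra. }
      assert (Hu : Cmod u = (Cmod w * q ^ k)%R)
        by (unfold u; rewrite Cmod_mult, Cmod_qpow_nat by lra; reflexivity).
      assert (Hw0 := Cmod_ge_0 w).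
      apply Cconv_Cmod_le with
        (2 := Cconv_plus _ _ _ _ (Cconv_shift _ _ (has_sum_Cconv _ _ (HF k))) (Cconv_const (- (1)))).
      intros n. fold u. cbn [seq csum fold_right].
      rewrite <- seq_shift. fold (csum (fun m => c m * u ^ m) (map S (seq 0 n))).
      rewrite csum_map.
      replace (_ + _) with (csum (fun m => c (S m) * u ^ S m) (seq 0 n))
        by (unfold c; simpl; field; apply C1_nz).
      apply Rle_trans with (B * q ^ k * rsum (fun m => Cmod w ^ m)%R (seq 0 n))%R.
      - induction (seq 0 n) as [|m s IH]; simpl; [rewrite Cmod_0; lra|].
        eapply Rle_trans; [apply Cmod_triangle|].
        rewrite Rmult_plus_distr_l. apply Rplus_le_compat; [|exact IH].
        replace (B * q ^ k * Cmod w ^ m)%R with (B * (q ^ k * Cmod w ^ m))%R by ring.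
        rewrite !Cmod_mult, Cmod_pow, Hu.
        apply Rmult_le_compat; [apply Cmod_ge_0| |apply HB|].
        { apply Rmult_le_pos; [nra|]. apply pow_le; nra. }
        apply Rmult_le_compat; [nra|apply pow_le; nra|nra|].
        apply pow_incr; nra.
      - assert (Hg := rsum_geom (Cmod w) n (conj Hw0 Hw)).
        assert (0 <= B * q ^ k)%R by (apply Rmult_le_pos; lra). nra. }
    intros eps He.
    assert (HM : (0 <= B * / (1 - Cmod w))%R)
      by (apply Rmult_le_pos; [exact HB0|left; apply Rinv_0_lt_compat; lra]).
    set (M := (B * / (1 - Cmod w))%R) in *.
    destruct (pow_lt_1_zero q) with (y := (eps / (M + 1))%R) as [N HN].
    { rewrite Rabs_pos_eq; lra. }
    { apply Rdiv_lt_0_compat; lra. }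
    exists N. intros n Hn. specialize (HN n Hn).
    rewrite Rabs_pos_eq in HN by (apply pow_le; lra).
    eapply Rle_lt_trans; [apply HFb|].
    assert (Hp : (0 < q ^ n)%R) by (apply pow_lt; lra).
    apply (Rmult_lt_compat_r (M + 1)) in HN; [|lra].
    unfold Rdiv in HN. rewrite Rmult_assoc, Rinv_l, Rmult_1_r in HN by lra. nra. }
  exists (F 0%nat). split.
  - apply has_sum_ext with (2 := HF 0%nat). intros m. simpl. rewrite Cmult_1_r. reflexivity.
  - apply (Cconv_unique (fun k => qpoch w q k * F 0%nat)).
    + apply Cconv_mult; [apply qpoch_inf_conv, Hq|apply Cconv_const].
    + rewrite <- (Cmult_1_r (qpoch_inf (a * w) q)).
      apply Cconv_ext with (2 := Cconv_mult _ _ _ _ (qpoch_inf_conv q (a * w) Hq) Hlim).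
      intros k; symmetry; apply Hiter.
Qed.

(** * Complex powers of q *)

Lemma Cexp_plus (a b : C) : Cexp (a + b) = Cexp a * Cexp b.
Proof.
  destruct a as [a1 a2], b as [b1 b2]. unfold Cexp, Cplus, Cmult, Re, Im. cbn [fst snd].
  rewrite exp_plus, cos_plus, sin_plus. f_equal; ring.
Qed.

Lemma Cexp_0 : Cexp 0 = 1.
Proof. unfold Cexp; simpl. rewrite exp_0, cos_0, sin_0. unfold RtoC. f_equal; ring. Qed.

Lemma Cmod_Cexp (w : C) : Cmod (Cexp w) = exp (Re w).
Proof.
  unfold Cmod, Cexp. cbn [fst snd].
  replace (_ + _)%R with ((exp (Re w)) ^ 2 * ((cos (Im w)) ^ 2 + (sin (Im w)) ^ 2))%R by ring.
  generalize (sin2_cos2 (Im w)). unfold Rsqr. intros H.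
  replace ((cos (Im w)) ^ 2 + (sin (Im w)) ^ 2)%R with 1%R by lra.
  rewrite Rmult_1_r. replace ((exp (Re w)) ^ 2)%R with (Rsqr (exp (Re w))) by (unfold Rsqr; ring).
  apply sqrt_Rsqr. left; apply exp_pos.
Qed.

Lemma Cexp_nat (k : nat) (w : C) : Cexp (INR k * w) = Cexp w ^ k.
Proof.
  induction k as [|k IH].
  - simpl. rewrite Cmult_0_l. apply Cexp_0.
  - rewrite S_INR, Cpow_S, <- IH, <- Cexp_plus. f_equal. rewrite RtoC_plus. ring.
Qed.

Lemma Cexp_ln (q : R) : (0 < q)%R -> Cexp (ln q) = q.
Proof.
  intros Hq. unfold Cexp, RtoC; simpl. rewrite exp_ln, cos_0, sin_0 by exact Hq. f_equal; ring.
Qed.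

Lemma qpow_plus (q : R) (a b : C) : qpow q (a + b) = qpow q a * qpow q b.
Proof. unfold qpow. rewrite <- Cexp_plus. f_equal. ring. Qed.

Lemma qpow_nat (q : R) (k : nat) : (0 < q)%R -> qpow q (INR k) = RtoC q ^ k.
Proof. intros Hq. unfold qpow. rewrite Cexp_nat, Cexp_ln by exact Hq. reflexivity. Qed.

Lemma qpow_1 (q : R) : (0 < q)%R -> qpow q 1 = q.
Proof. intros Hq. unfold qpow. rewrite Cmult_1_l. apply Cexp_ln, Hq. Qed.

Lemma qpow_0 (q : R) : qpow q 0 = 1.
Proof. unfold qpow. rewrite Cmult_0_l. apply Cexp_0. Qed.

Lemma Cmod_qpow (q : R) (a : C) : Cmod (qpow q a) = exp (Re a * ln q).
Proof.
  unfold qpow. rewrite Cmod_Cexp, re_scal_r. reflexivity.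
Qed.

Lemma neg1_sqr (n : nat) : (- (1)) ^ n * (- (1)) ^ n = RtoC 1.
Proof.
  induction n as [|n IH]; [simpl; ring|]. rewrite Cpow_S.
  transitivity ((- (1)) ^ n * (- (1)) ^ n); [ring|exact IH].
Qed.

Lemma Cmod_neg1_pow (n : nat) : Cmod ((- (1)) ^ n) = 1%R.
Proof. rewrite Cmod_pow, Cmod_m1. apply pow1. Qed.

(** * q-shifted factorials at powers of q *)

(** Let S_n be the left-hand side.  Writing
    1 - q^(n+1) = (1 - q^(n+1-j)) + q^(n+1-j) (1 - q^j) in each term of S_(n+1)
    gives (1 - q^(n+1)) S_(n+1) = (1 - u q^n) S_n. *)
Lemma finite_q_binomial (q : R) (u : C) (n : nat) : (0 < q < 1)%R ->
  csum (fun j => (- (1)) ^ j * qpow q (INR j * (INR j - 1) / 2) * u ^ j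
                 / (qpoch q q j * qpoch q q (n - j))) (seq 0 (S n))
  = qpoch u q n / qpoch q q n.
Proof.
  intros Hq. assert (Hn0 := fun k => qpoch_q_neq0 q k Hq).
  induction n as [|n IH].
  - simpl. replace (0 * (0 - 1) / 2) with (RtoC 0) by field.
    rewrite qpow_0. field.
  - set (T := fun n j => (- (1)) ^ j * qpow q (INR j * (INR j - 1) / 2) * u ^ j
                 / (qpoch q q j * qpoch q q (n - j))) in *.
    assert (HqS : 1 - RtoC q ^ S n <> 0).
    { intros E. apply (Hn0 (S n)). cbn [qpoch]. rewrite <- Cpow_S, E. ring. }
    (* A and B are the two parts of the split term; B j comes from index j - 1 of S_n *)
    pose (A := fun j => if Nat.leb j n then T n j else RtoC 0).
    pose (B := fun j => match j with O => RtoC 0 | S i => - (u * RtoC q ^ n) * T n i end).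
    assert (Hterm : forall j, In j (seq 0 (S (S n))) ->
      (1 - RtoC q ^ S n) * T (S n) j = A j + B j).
    { intros j Hj%in_seq. unfold A, B.
      assert (HT1 : (j <= n)%nat ->
        T n j = (1 - RtoC q ^ (S n - j)) * T (S n) j).
      { intros Hjn. unfold T. replace (S n - j)%nat with (S (n - j)) by lia.
        assert (H1 := Hn0 (S (n - j))). cbn [qpoch] in H1 |- *.
        rewrite Cpow_S. field.
        repeat split; first [apply Hn0 | intros E; apply H1; rewrite E; ring]. }
      assert (HT2 : forall i, j = S i ->
        - (u * RtoC q ^ n) * T n i = RtoC q ^ (S n - j) * (1 - RtoC q ^ j) * T (S n) j).
      { intros i ->. unfold T. replace (S n - S i)%nat with (n - i)%nat by lia.
        assert (H1 := Hn0 (S i)). cbn [qpoch] in H1 |- *.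
        replace (qpow q (INR (S i) * (INR (S i) - 1) / 2))
          with (qpow q (INR i * (INR i - 1) / 2) * RtoC q ^ i).
        2:{ rewrite <- qpow_nat, <- qpow_plus by lra. f_equal.
            rewrite S_INR, RtoC_plus. field. }
        replace n with (i + (n - i))%nat at 1 by lia.
        rewrite Cpow_add_r, !Cpow_S. field.
        repeat split; first [apply Hn0 | intros E; apply H1; rewrite E; ring]. }
      destruct (Nat.leb_spec j n) as [Hjn|Hjn].
      - rewrite HT1 by exact Hjn. destruct j as [|i].
        + replace (S n - 0)%nat with (S n) by lia. ring.
        + rewrite (HT2 i eq_refl).
          replace (RtoC q ^ S n) with (RtoC q ^ (S n - S i) * RtoC q ^ S i); [ring|].
          rewrite <- Cpow_add_r. f_equal; lia.
      - assert (j = S n) as -> by lia. rewrite (HT2 n eq_refl).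
        rewrite Nat.sub_diag. cbn [Cpow]. ring. }
    assert (HA : csum A (seq 0 (S (S n))) = csum (T n) (seq 0 (S n))).
    { rewrite (seq_S (S n)), csum_app.
      replace (csum A [(0 + S n)%nat]) with (RtoC 0).
      - rewrite Cplus_0_r. apply csum_ext. intros j Hj%in_seq. unfold A.
        destruct (Nat.leb_spec j n); [reflexivity|lia].
      - cbn [csum fold_right]. unfold A.
        destruct (Nat.leb_spec (0 + S n) n); [lia|ring]. }
    assert (HB : csum B (seq 0 (S (S n))) = - (u * RtoC q ^ n) * csum (T n) (seq 0 (S n))).
    { change (seq 0 (S (S n))) with (0%nat :: seq 1 (S n)).
      rewrite <- seq_shift. cbn [csum fold_right].
      fold (csum B (map S (seq 0 (S n)))). rewrite csum_map, <- csum_scal.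
      unfold B at 1. rewrite Cplus_0_l. reflexivity. }
    fold (T (S n)).
    transitivity ((1 - RtoC q ^ S n) * csum (T (S n)) (seq 0 (S (S n)))
                    / (1 - RtoC q ^ S n)); [field; exact HqS|].
    rewrite <- csum_scal, (csum_ext _ _ _ Hterm), csum_plus, HA, HB.
    fold (T n) in IH. rewrite IH. cbn [qpoch]. rewrite <- Cpow_S. field.
    repeat split; first [apply Hn0 | exact HqS].
Qed.

(** The factor with index d is 1 - q^(-d) q^d. *)
Lemma qpoch_qpow_neg_eq0 (q : R) (d n : nat) : (0 < q < 1)%R -> (d < n)%nat ->
  qpoch (qpow q (- INR d)) q n = 0.
Proof.
  intros Hq Hdn. induction n as [|n IH]; [lia|].
  cbn [qpoch]. destruct (Nat.eq_dec d n) as [->|Hne].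
  - rewrite <- qpow_nat, <- qpow_plus by lra.
    replace (- INR n + INR n) with (RtoC 0) by ring. rewrite qpow_0. ring.
  - rewrite IH by lia. ring.
Qed.

(** Reversal of a product: 1 - q^(-k) = - q^(-k) (1 - q^k) for each factor. *)
Lemma qpoch_qpow_neg (q : R) (n d : nat) : (0 < q < 1)%R ->
  qpoch (qpow q (- INR (n + d))) q n * qpoch q q d
  = (- (1)) ^ n * qpow q (- (INR (n + d) * INR n) + INR n * (INR n - 1) / 2)
    * qpoch q q (n + d).
Proof.
  intros Hq. induction n as [|n IH].
  - simpl. replace (- (INR d * 0) + 0 * (0 - 1) / 2) with (RtoC 0) by field.
    rewrite qpow_0. ring.
  - rewrite qpoch_Sl.
    replace (qpow q (- INR (S n + d)) * q) with (qpow q (- INR (n + d))).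
    2:{ rewrite <- (qpow_1 q), <- qpow_plus by lra. f_equal.
        cbn [Nat.add]. rewrite S_INR, RtoC_plus. ring. }
    transitivity ((1 - qpow q (- INR (S n + d))) *
      (qpoch (qpow q (- INR (n + d))) q n * qpoch q q d)); [ring|].
    rewrite IH. cbn [Nat.add]. cbn [qpoch].
    replace (qpow q (- (INR (S (n + d)) * INR (S n)) + INR (S n) * (INR (S n) - 1) / 2))
      with (qpow q (- (INR (n + d) * INR n) + INR n * (INR n - 1) / 2)
              * qpow q (- INR (S (n + d)))).
    2:{ rewrite <- qpow_plus. f_equal. rewrite !S_INR, plus_INR, !RtoC_plus. field. }
    replace (RtoC q * RtoC q ^ (n + d)) with (qpow q (INR (S (n + d))))
      by (rewrite qpow_nat by lra; apply Cpow_S).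
    set (v := qpow q (- INR (S (n + d)))).
    assert (Hv : v * qpow q (INR (S (n + d))) = 1).
    { unfold v. rewrite <- qpow_plus, Cplus_comm, Cplus_opp_r. apply qpow_0. }
    rewrite Cpow_S.
    transitivity ((- (1)) ^ n * qpow q (- (INR (n + d) * INR n) + INR n * (INR n - 1) / 2)
      * qpoch q q (n + d) * (v * qpow q (INR (S (n + d))) - v)); [rewrite Hv; ring|ring].
Qed.

Lemma qpoch_inf_qpow_step (q : R) (a : C) : (0 < q < 1)%R ->
  qpoch_inf (qpow q a) q = (1 - qpow q a) * qpoch_inf (qpow q (a + 1)) q.
Proof.
  intros Hq. rewrite qpoch_inf_step by exact Hq.
  rewrite qpow_plus, qpow_1 by lra. reflexivity.
Qed.

(** This identifies the coefficients of the Bessel functions of integer order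
    k: at m they are 1/(q;q)_(k+m), up to the sign and powers of q. *)
Lemma qpoch_inf_qpow_nat (q : R) (j : nat) : (0 < q < 1)%R ->
  qpoch_inf (qpow q (INR j + 1)) q / qpoch_inf q q = / qpoch q q j.
Proof.
  intros Hq. assert (HP := qpoch_inf_q_neq0 q Hq).
  assert (H : qpoch_inf (qpow q (INR j + 1)) q * qpoch q q j = qpoch_inf q q).
  { induction j as [|j IH].
    - simpl. rewrite Cplus_0_l, qpow_1 by lra. ring.
    - rewrite <- IH, (qpoch_inf_qpow_step q (INR j + 1) Hq), S_INR, RtoC_plus.
      cbn [qpoch]. rewrite <- Cpow_S, <- (qpow_nat q (S j)), S_INR, RtoC_plus by lra. ring. }
  assert (Hj := qpoch_q_neq0 q j Hq). rewrite <- H. field. split; [exact Hj|].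
  intros E. apply HP. rewrite <- H, E. ring.
Qed.

(** Integer order k has no terms with k + m < 0, so that j = k + m can be used
    as a summation variable over the naturals. *)
Lemma qpoch_inf_qpow_neg (q : R) (i : nat) : (0 < q < 1)%R ->
  qpoch_inf (qpow q (- INR i)) q = 0.
Proof.
  intros Hq. induction i as [|i IH].
  - rewrite qpoch_inf_qpow_step by exact Hq. simpl.
    rewrite Copp_0, qpow_0. ring.
  - rewrite qpoch_inf_qpow_step by exact Hq.
    replace (- INR (S i) + 1) with (- INR i) by (rewrite S_INR, RtoC_plus; ring).
    rewrite IH. ring.
Qed.

(** * The tail factor (q^(nu+l+1);q)_oo along the integers *)

(** q^(nu l + l(l+1)/2) (q^(nu+l+1);q)_oo.  With this power of q the factor
    satisfies a recurrence in l that produces a finite q-shifted factorial, and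
    it stays bounded as l tends to -oo. *)
Definition gtail (q : R) (nu : C) (l : Z) : C :=
  qpow q (nu * IZR l + IZR l * (IZR l + 1) / 2) * qpoch_inf (qpow q (nu + IZR l + 1)) q.

Lemma gtail_pred (q : R) (nu : C) (l : Z) : (0 < q < 1)%R ->
  gtail q nu (l - 1) = - (1 - qpow q (- nu - IZR l)) * gtail q nu l.
Proof.
  intros Hq. unfold gtail. rewrite minus_IZR, RtoC_minus.
  replace (nu + (IZR l - 1) + 1) with (nu + IZR l) by ring.
  rewrite (qpoch_inf_qpow_step q (nu + IZR l) Hq).
  replace (nu * IZR l + IZR l * (IZR l + 1) / 2) with
    ((nu * (IZR l - 1) + (IZR l - 1) * (IZR l - 1 + 1) / 2) + (nu + IZR l)) by field.
  rewrite (qpow_plus q (_ + _) (nu + IZR l)).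
  set (v := qpow q (nu + IZR l)).
  assert (Hv : qpow q (- nu - IZR l) * v = 1).
  { unfold v. rewrite <- qpow_plus.
    replace (- nu - IZR l + (nu + IZR l)) with (RtoC 0) by ring. apply qpow_0. }
  set (e := qpow q (nu * (IZR l - 1) + _)). set (p := qpoch_inf _ q).
  transitivity (e * p * (qpow q (- nu - IZR l) * v - v)); [rewrite Hv; ring|ring].
Qed.

(** Iterated recurrence; it turns the dependence on m into the numerator
    (q^(-nu-n);q)_m of a q-binomial series. *)
Lemma gtail_minus (q : R) (nu : C) (n : Z) (m : nat) : (0 < q < 1)%R ->
  gtail q nu (n - Z.of_nat m)
  = (- (1)) ^ m * qpoch (qpow q (- nu - IZR n)) q m * gtail q nu n.
Proof.
  intros Hq. induction m as [|m IH].
  - rewrite Z.sub_0_r. simpl. ring.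
  - replace (n - Z.of_nat (S m))%Z with (n - Z.of_nat m - 1)%Z by lia.
    rewrite gtail_pred, IH by exact Hq. cbn [qpoch].
    replace (qpow q (- nu - IZR (n - Z.of_nat m)))
      with (qpow q (- nu - IZR n) * RtoC q ^ m); [rewrite Cpow_S; ring|].
    rewrite <- qpow_nat, <- qpow_plus by lra. f_equal.
    rewrite minus_IZR, <- INR_IZR_INZ, RtoC_minus. ring.
Qed.

Lemma ln_neg (q : R) : (0 < q < 1)%R -> (ln q < 0)%R.
Proof. intros Hq. rewrite <- ln_1. apply ln_increasing; lra. Qed.

Lemma qpoch_inf_qpow_bound (q : R) (a : C) (c : R) : (0 < q < 1)%R -> (c <= Re a)%R ->
  (Cmod (qpoch_inf (qpow q a) q) <= exp (exp (c * ln q) / (1 - q)))%R.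
Proof.
  intros Hq Hc. eapply Rle_trans; [apply qpoch_inf_bound, Hq|]. apply exp_mono.
  apply Rmult_le_compat_r; [left; apply Rinv_0_lt_compat; lra|].
  rewrite Cmod_qpow. apply exp_mono. generalize (ln_neg q Hq); nra.
Qed.

(** For l >= 0 the infinite product is bounded, so the power of q gives the
    size.  For l = -p the recurrence from l = 0 gives a factor
    (q^(-nu);q)_p, which is bounded in p. *)
Lemma gtail_bound (q : R) (nu : C) : (0 < q < 1)%R ->
  exists B : R, (0 <= B)%R /\ forall l : Z,
  (Cmod (gtail q nu l) <= B * (if (0 <=? l)%Z then
     exp (ln q * (Re nu * IZR l + IZR l * (IZR l + 1) / 2)) else 1))%R.
Proof.
  intros Hq.
  set (B1 := exp (exp (Re nu * ln q) / (1 - q))).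
  set (B2 := (exp (Cmod (qpow q (- nu)) / (1 - q)) * Cmod (gtail q nu 0))%R).
  assert (HB1 : (0 <= B1)%R) by (left; apply exp_pos).
  assert (HB2 : (0 <= B2)%R).
  { apply Rmult_le_pos; [left; apply exp_pos|apply Cmod_ge_0]. }
  exists (B1 + B2)%R. split; [lra|]. intros l.
  destruct (Z.leb_spec 0 l) as [Hl|Hl].
  - unfold gtail. rewrite Cmod_mult, Cmod_qpow.
    replace (Re (nu * IZR l + IZR l * (IZR l + 1) / 2))
      with (Re nu * IZR l + IZR l * (IZR l + 1) / 2)%R.
    2:{ replace (nu * IZR l + IZR l * (IZR l + 1) / 2)
        with (nu * IZR l + RtoC (IZR l * (IZR l + 1) / 2)).
        - cbn [Re fst Cplus]. rewrite re_scal_r. reflexivity.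
        - f_equal. rewrite RtoC_div, RtoC_mult, RtoC_plus by lra. reflexivity. }
    rewrite (Rmult_comm (_ + _) (ln q)), Rmult_comm.
    apply Rmult_le_compat_r; [left; apply exp_pos|].
    apply Rle_trans with B1; [|lra]. apply qpoch_inf_qpow_bound; [exact Hq|].
    apply IZR_le in Hl. destruct nu as [n1 n2]. simpl. lra.
  - replace l with (0 - Z.of_nat (Z.to_nat (- l)))%Z by lia.
    rewrite gtail_minus by exact Hq. rewrite !Cmod_mult, Cmod_neg1_pow, Rmult_1_l, Rmult_1_r.
    apply Rle_trans with B2; [|lra].
    apply Rmult_le_compat_r; [apply Cmod_ge_0|].
    replace (- nu - IZR 0) with (- nu) by ring. apply qpoch_bound, Hq.
Qed.

Lemma re_INR_triangle (n : nat) :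
  RtoC (INR n) * (RtoC (INR n) + 1) / 2 = RtoC (INR n * (INR n + 1) / 2).
Proof. rewrite RtoC_div, RtoC_mult, RtoC_plus by lra. reflexivity. Qed.

(** * The Hahn-Exton function as an unordered sum *)

(** The terms of the series of J_alpha(z;q)/z^alpha, where w is a logarithm of
    z^2: all powers are written as exponentials, so that identities between
    monomials reduce to identities between exponents. *)
Definition hterm (q : R) (alpha w : C) (k : nat) : C :=
  qpoch_inf (qpow q (alpha + INR k + 1)) q / qpoch_inf q q
  * ((- (1)) ^ k / qpoch q q k)
  * Cexp (ln q * (INR k * (INR k + 1) / 2) + INR k * w).

(** Completing the square. *)
Lemma quad_bound (lam a t : R) : (0 < lam)%R ->
  (a * t - lam * t ^ 2 / 2 <= a ^ 2 / (2 * lam))%R.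
Proof.
  intros Hl.
  assert (E : (a ^ 2 / (2 * lam) - (a * t - lam * t ^ 2 / 2)
               = / (2 * lam) * (a - lam * t) ^ 2)%R) by (field; lra).
  assert (0 <= / (2 * lam) * (a - lam * t) ^ 2)%R; [|lra].
  apply Rmult_le_pos; [left; apply Rinv_0_lt_compat; lra|apply pow2_ge_0].
Qed.

(** The Gaussian factor q^(k(k+1)/2) beats any exponential exp (k w). *)
Lemma summable_hterm (q : R) (alpha w : C) : (0 < q < 1)%R ->
  summable (fun k => Cmod (hterm q alpha w k)).
Proof.
  intros Hq. assert (HL := ln_neg q Hq). set (lam := (- ln q)%R).
  assert (Hlam : (0 < lam)%R) by (unfold lam; lra).
  set (B := (exp (exp (Re alpha * ln q) / (1 - q)) * Cmod (/ qpoch_inf q q)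
             * exp (/ (1 - q) ^ 2))%R).
  assert (HB : (0 <= B)%R).
  { apply Rmult_le_pos; [apply Rmult_le_pos|]; try apply Cmod_ge_0; left; apply exp_pos. }
  set (K := ((Re w + 1 - lam / 2) ^ 2 / (2 * lam))%R).
  apply summable_le with (fun k => (B * exp K) * exp (- (1)) ^ k)%R.
  - intros k. unfold hterm, Cdiv. rewrite !Cmod_mult, Cmod_neg1_pow, Rmult_1_l.
    rewrite Rmult_assoc with (r1 := B). apply Rmult_le_compat.
    + repeat apply Rmult_le_pos; apply Cmod_ge_0.
    + apply Cmod_ge_0.
    + unfold B. apply Rmult_le_compat; [apply Rmult_le_pos; apply Cmod_ge_0|apply Cmod_ge_0| |].
      * apply Rmult_le_compat_r; [apply Cmod_ge_0|].
        apply qpoch_inf_qpow_bound; [exact Hq|]. destruct alpha. simpl.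
        generalize (pos_INR k). simpl. lra.
      * apply Cinv_qpoch_bound, Hq.
    + rewrite Cmod_Cexp, <- exp_pow, <- exp_plus. apply exp_mono.
      fold (Cdiv (INR k * (INR k + 1)) 2). rewrite re_INR_triangle, <- RtoC_mult.
      cbn [Re fst Cplus]. rewrite re_scal_l. cbn [RtoC fst].
      generalize (quad_bound lam (Re w + 1 - lam / 2) (INR k) Hlam). fold K.
      unfold lam. lra.
  - apply summable_scal.
    + apply Rmult_le_pos; [exact HB|left; apply exp_pos].
    + apply summable_geom. split; [left; apply exp_pos|].
      apply exp_neg_lt1; lra.
Qed.

Definition hsum (q : R) (alpha w : C) : C := Cseries (hterm q alpha w).

Lemma has_sum_hterm (q : R) (alpha w : C) : (0 < q < 1)%R ->
  has_sum (hterm q alpha w) (hsum q alpha w).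
Proof.
  intros Hq. destruct (summable_has_sum _ (summable_hterm q alpha w Hq)) as [l Hl].
  unfold hsum. rewrite (has_sum_Cseries _ _ Hl). exact Hl.
Qed.

Lemma INR_triangle (k : nat) : INR (k * (k + 1) / 2) = (INR k * (INR k + 1) / 2)%R.
Proof.
  assert (H : (2 * (k * (k + 1) / 2) = k * (k + 1))%nat).
  { induction k as [|k IH]; [reflexivity|].
    replace (S k * (S k + 1))%nat with (k * (k + 1) + (k + 1) * 2)%nat by lia.
    rewrite Nat.div_add by lia. lia. }
  apply (f_equal INR) in H. rewrite !mult_INR, plus_INR in H. change (INR 2) with 2%R in H. change (INR 1) with 1%R in H. lra.
Qed.

Lemma HahnExton_hsum (q : R) (alpha w z zalpha : C) : (0 < q < 1)%R ->
  z * z = Cexp w -> HahnExton q alpha z zalpha = zalpha * hsum q alpha w.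
Proof.
  intros Hq Hz. unfold HahnExton. f_equal. apply has_sum_Cseries.
  apply has_sum_ext with (2 := has_sum_hterm q alpha w Hq). intros k. unfold hterm.
  rewrite Cexp_plus, (Cexp_nat k w), <- Hz, Cpow_mult_r.
  replace (z ^ 2) with (z * z) by (simpl; ring).
  replace (RtoC q ^ (k * (k + 1) / 2)) with (Cexp (ln q * (INR k * (INR k + 1) / 2))).
  - unfold Cdiv. ring.
  - rewrite <- qpow_nat by lra. unfold qpow. rewrite INR_triangle, <- re_INR_triangle.
    f_equal. ring.
Qed.

Lemma J_Rqpow_hsum (q : R) (r logr alpha a : C) : (0 < q < 1)%R -> Cexp logr = r ->
  J_Rqpow q r logr alpha a
  = Cexp (alpha * logr + a * alpha * ln q) * hsum q alpha (2 * logr + 2 * a * ln q).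
Proof.
  intros Hq Hr. unfold J_Rqpow.
  rewrite (HahnExton_hsum q alpha (2 * logr + 2 * a * ln q)); [|exact Hq|].
  - rewrite Cexp_plus. reflexivity.
  - rewrite <- Hr. unfold qpow. rewrite <- !Cexp_plus. f_equal. ring.
Qed.

Lemma J_qpow_hsum (q : R) (alpha a : C) : (0 < q < 1)%R ->
  J_qpow q alpha a = Cexp (a * alpha * ln q) * hsum q alpha (2 * a * ln q).
Proof.
  intros Hq. unfold J_qpow. apply HahnExton_hsum; [exact Hq|].
  unfold qpow. rewrite <- !Cexp_plus. f_equal. ring.
Qed.

(** * The right-hand side as a quadruple series *)

(** The k-th term of the right-hand side with its three Bessel functions
    expanded; p = (m, b, d) lists the summation indices in their order. *)
Definition rhs_term (q : R) (logr x y nu z : C) (k : Z) (p : nat * nat * nat) : C :=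
  Cexp (IZR k * logr + (x + y + IZR k) / 2 * IZR k * ln q)
  * Cexp ((nu + IZR k) * logr + (y + IZR k + nu) / 2 * (nu + IZR k) * ln q)
  * Cexp ((z - IZR k) / 2 * x * ln q)
  * (hterm q (IZR k) (2 * logr + 2 * ((x + y + IZR k) / 2) * ln q) (fst (fst p))
     * hterm q (nu + IZR k) (2 * logr + 2 * ((y + IZR k + nu) / 2) * ln q) (snd (fst p))
     * hterm q x (2 * ((z - IZR k) / 2) * ln q) (snd p)).

(** The expanded right-hand side in the variables j = k + m, b, d, m.  The
    order k survives only in the tail factor, through nu + k + b = nu + (j + b) - m. *)
Definition quad_term (q : R) (logr x y nu z : C) (j b d m : nat) : C :=
  Cexp (nu * logr + ln q * (nu * y + nu * nu + x * z) / 2)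
  / (qpoch_inf q q * qpoch_inf q q)
  * ((- (1)) ^ m * (- (1)) ^ b * (- (1)) ^ d)
  * gtail q nu (Z.of_nat (j + b) - Z.of_nat m)
  * qpoch_inf (qpow q (x + INR d + 1)) q
  * (/ qpoch q q j * / qpoch q q m * / qpoch q q b * / qpoch q q d)
  * Cexp (INR (j + b) * (2 * logr + y * ln q) + INR m * ((x + 1) * ln q)
          + ln q * (INR j * (INR j - 1) / 2 + INR d * (INR d + 1) / 2
                    - INR j * INR d + INR m * INR d) + INR d * (z * ln q)).

Lemma rhs_term_neg (q : R) (logr x y nu z : C) (k : Z) (p : nat * nat * nat) :
  (0 < q < 1)%R -> (k + Z.of_nat (fst (fst p)) < 0)%Z ->
  rhs_term q logr x y nu z k p = 0.
Proof.
  intros Hq Hk. unfold rhs_term. unfold hterm at 1.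
  set (m := fst (fst p)) in *.
  replace (IZR k + INR m + 1) with (- INR (Z.to_nat (- (k + Z.of_nat m) - 1))).
  - rewrite qpoch_inf_qpow_neg by exact Hq. unfold Cdiv. ring.
  - rewrite !INR_IZR_INZ, Z2Nat.id by lia.
    rewrite minus_IZR, opp_IZR, plus_IZR, RtoC_minus, RtoC_opp, RtoC_plus. ring.
Qed.

(** All exponentials on each side are merged into one, and the exponents agree
    as polynomials in the indices. *)
Lemma rhs_term_quad (q : R) (logr x y nu z : C) (j b d m : nat) : (0 < q < 1)%R ->
  rhs_term q logr x y nu z (Z.of_nat j - Z.of_nat m) (m, b, d)
  = quad_term q logr x y nu z j b d m.
Proof.
  intros Hq. unfold rhs_term, quad_term, hterm, gtail. cbn [fst snd].
  rewrite !minus_IZR, <- !INR_IZR_INZ, !RtoC_minus, plus_INR, RtoC_plus.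
  replace (INR j - INR m + INR m + 1) with (INR j + 1) by ring.
  rewrite qpoch_inf_qpow_nat by exact Hq.
  replace (nu + (INR j - INR m) + INR b + 1) with (nu + (INR j + INR b - INR m) + 1) by ring.
  set (P := qpoch_inf q q). set (g := qpoch_inf (qpow q (nu + _ + 1)) q).
  set (h := qpoch_inf (qpow q (x + INR d + 1)) q).
  assert (HP : P <> 0) by exact (qpoch_inf_q_neq0 q Hq).
  unfold qpow.
  match goal with |- Cexp ?a1 * Cexp ?a2 * Cexp ?a3 *
     (_ * Cexp ?a4 * (_ * Cexp ?a5) * (_ * Cexp ?a6)) =
     Cexp ?b1 / _ * _ * (Cexp ?b2 * _) * _ * _ * Cexp ?b3 =>
   assert (E : Cexp a1 * Cexp a2 * Cexp a3 * Cexp a4 * Cexp a5 * Cexp a6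
               = Cexp b1 * Cexp b2 * Cexp b3) by
     (rewrite <- !Cexp_plus; f_equal; field);
   generalize dependent (Cexp a1); intros A1;
   generalize dependent (Cexp a2); intros A2;
   generalize dependent (Cexp a3); intros A3;
   generalize dependent (Cexp a4); intros A4;
   generalize dependent (Cexp a5); intros A5;
   generalize dependent (Cexp a6); intros A6;
   generalize dependent (Cexp b1); intros B1;
   generalize dependent (Cexp b2); intros B2;
   generalize dependent (Cexp b3); intros B3
  end.
  intros E.
  assert (Hj := qpoch_q_neq0 q j Hq). assert (Hm := qpoch_q_neq0 q m Hq).
  assert (Hb := qpoch_q_neq0 q b Hq). assert (Hd := qpoch_q_neq0 q d Hq).
  transitivity (A1 * A2 * A3 * A4 * A5 * A6 * (g * h * ((- (1)) ^ m * (- (1)) ^ b * (- (1)) ^ d))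
    / (P * P * qpoch q q j * qpoch q q m * qpoch q q b * qpoch q q d)).
  - field. tauto.
  - rewrite E. field. tauto.
Qed.

(** * Absolute convergence of the quadruple series *)

(** The logarithm of |quad_term|, up to a bounded amount, with lam = -log q;
    tau, xi and zeta are the exponents of the powers with n = j + b, m and
    d, and G is that of the tail factor.  Put l = n - m and i = j - d.

    The linear terms are m (tau + xi) + l tau if l >= 0, and
    n (tau + xi) + (m - n) xi if l < 0; both decay in m by hypothesis.  The
    Gaussian terms -lam l^2/2 (for l >= 0) and -lam i^2/2 absorb every linear
    growth in l and |i|.  The remaining term d (zeta - lam m) can only be
    positive when m is bounded; as d <= j + |i| and j <= n, it is then
    at most linear in l and |i|.  Finally j + b + d + m <= 3 (m + max(l,0) + |i|). *)
Lemma quad_exponent_bound (lam tau xi zeta n0 rho : R) :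
  (0 < lam)%R -> (0 < rho)%R -> (xi <= - rho)%R -> (tau + xi <= - rho)%R ->
  exists K : R, forall j b d m G : R,
  (0 <= j)%R -> (0 <= b)%R -> (0 <= d)%R -> (0 <= m)%R ->
  (0 <= j + b - m -> G <= - lam * (n0 * (j + b - m) + (j + b - m) * (j + b - m + 1) / 2))%R ->
  (j + b - m < 0 -> G <= 0)%R ->
  (G + ((j + b) * tau + m * xi
   - lam * (j * (j - 1) / 2 + d * (d + 1) / 2 - j * d + m * d) + d * zeta)
   <= K - rho / 3 * (j + b + d + m))%R.
Proof.
  intros Hlam Hrho Hxi Hti.
  set (K1 := ((Rabs tau + lam * Rabs n0 + Rabs zeta + rho) ^ 2 / (2 * lam))%R).
  set (K2 := ((Rabs zeta + lam / 2 + rho) ^ 2 / (2 * lam))%R).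
  set (K3 := (zeta ^ 2 / lam)%R).
  exists (K1 + K2 + K3)%R. intros j b d m G Hj Hb Hd Hm HG1 HG2.
  assert (HK1 : (0 <= K1)%R).
  { apply Rmult_le_pos; [apply pow2_ge_0|left; apply Rinv_0_lt_compat; lra]. }
  set (i := (j - d)%R). set (a := Rabs i).
  assert (Ha0 : (0 <= a)%R) by apply Rabs_pos.
  assert (Ha2 : (a ^ 2 = i ^ 2)%R) by apply pow2_abs.
  assert (Hai : (i <= a)%R) by apply Rle_abs.
  assert (Hai' : (- i <= a)%R) by (unfold a; rewrite <- Rabs_Ropp; apply Rle_abs).
  assert (Hz0 : (0 <= Rabs zeta)%R) by apply Rabs_pos.
  assert (Hz1 : (zeta <= Rabs zeta)%R) by apply Rle_abs.
  (* mu is the positive part of zeta - lam m; it is 0 once m >= zeta / lam,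
     hence mu m <= zeta^2 / lam *)
  set (mu := Rmax 0 (zeta - lam * m)).
  assert (Hmu0 : (0 <= mu)%R) by apply Rmax_l.
  assert (Hmu1 : (zeta - lam * m <= mu)%R) by apply Rmax_r.
  assert (Hmu2 : (mu <= Rabs zeta)%R) by (apply Rmax_lub; nra).
  assert (Hmum : (mu * m <= K3)%R).
  { unfold mu, Rmax. destruct (Rle_dec 0 (zeta - lam * m)) as [H|H].
    - assert (HK : (zeta ^ 2 = K3 * lam)%R) by (unfold K3; field; lra).
      assert (m * lam <= zeta)%R by lra.
      assert (((zeta - lam * m) * m) * lam <= K3 * lam)%R by nra.
      apply Rmult_le_reg_r with lam; assumption.
    - rewrite Rmult_0_l. unfold K3.
      apply Rmult_le_pos; [apply pow2_ge_0|left; apply Rinv_0_lt_compat; lra]. }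
  assert (Hd1 : (d * zeta - lam * (m * d) <= mu * d)%R) by nra.
  assert (Hq2 := quad_bound lam (Rabs zeta + lam / 2 + rho) a Hlam). fold K2 in Hq2.
  assert (Hi2 : (j * (j - 1) / 2 + d * (d + 1) / 2 - j * d = (i ^ 2 - i) / 2)%R)
    by (unfold i; field).
  assert (Hdj : (d <= j + a)%R) by (unfold i in Hai'; lra).
  set (l := (j + b - m)%R) in *.
  assert (Hmua : (mu * a <= Rabs zeta * a)%R) by (apply Rmult_le_compat_r; assumption).
  assert (Hmud : (mu * d <= mu * j + mu * a)%R) by nra.
  replace (lam * (j * (j - 1) / 2 + d * (d + 1) / 2 - j * d + m * d))%R
    with (lam * ((i ^ 2 - i) / 2) + lam * (m * d))%R by (rewrite <- Hi2; ring).
  destruct (Rle_lt_dec 0 l) as [Hl|Hl].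
  - assert (Hq1 := quad_bound lam (Rabs tau + lam * Rabs n0 + Rabs zeta + rho) l Hlam).
    fold K1 in Hq1. specialize (HG1 Hl).
    assert (Hmuj : (mu * j <= K3 + Rabs zeta * l)%R).
    { apply Rle_trans with (mu * (m + l))%R; [apply Rmult_le_compat_l; [exact Hmu0|unfold l; lra]|].
      nra. }
    assert (Ht : (l * tau <= l * Rabs tau)%R)
      by (apply Rmult_le_compat_l; [exact Hl|apply Rle_abs]).
    assert (Hn : (- lam * (n0 * l) <= lam * Rabs n0 * l)%R).
    { assert (- n0 <= Rabs n0)%R by (rewrite <- Rabs_Ropp; apply Rle_abs).
      assert (- n0 * l <= Rabs n0 * l)%R by (apply Rmult_le_compat_r; assumption). nra. }
    assert (Hmt : ((j + b) * tau + m * xi <= - rho * m + l * tau)%R).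
    { replace ((j + b) * tau + m * xi)%R with (m * (tau + xi) + l * tau)%R by (unfold l; ring).
      nra. }
    assert (Hbase : (- rho * m - rho * l - rho * a <= - (rho / 3) * (j + b + d + m))%R).
    { assert (j + b + d + m <= 3 * (m + l + a))%R by (unfold l in *; lra). nra. }
    nra.
  - specialize (HG2 Hl).
    assert (Hmuj : (mu * j <= K3)%R).
    { apply Rle_trans with (mu * m)%R; [|exact Hmum].
      apply Rmult_le_compat_l; [exact Hmu0|unfold l in Hl; lra]. }
    assert (Hmt : ((j + b) * tau + m * xi <= - rho * m)%R).
    { replace ((j + b) * tau + m * xi)%R with ((j + b) * (tau + xi) + (- l) * xi)%R
        by (unfold l; ring).
      replace (- rho * m)%R with ((j + b) * (- rho) + (- l) * (- rho))%R by (unfold l; ring).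
      apply Rplus_le_compat; apply Rmult_le_compat_l; lra. }
    assert (Hbase : (- rho * m - rho * a <= - (rho / 3) * (j + b + d + m))%R).
    { assert (j + b + d + m <= 3 * (m + a))%R by (unfold l in *; lra). nra. }
    nra.
Qed.

(** The exponent bound makes the family dominated by a constant times
    delta^(j+b+d+m) with delta < 1.  The hypotheses on x and y say that
    |q^(1+x)| < 1 and |R^2 q^(1+x+y)| < 1. *)
Lemma summable_quad_term (q : R) (logr x y nu z : C) : (0 < q < 1)%R ->
  (Re x > -1)%R -> (2 * Re logr + (1 + Re x + Re y) * ln q < 0)%R ->
  summable (fun p : nat * nat * nat * nat =>
    Cmod (quad_term q logr x y nu z
            (fst (fst (fst p))) (snd (fst (fst p))) (snd (fst p)) (snd p))).
Proof.
  intros Hq Hx Hxy. assert (HL := ln_neg q Hq).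
  destruct (gtail_bound q nu Hq) as [B [HB0 HB]].
  set (tau := (2 * Re logr + Re y * ln q)%R).
  set (xi := ((Re x + 1) * ln q)%R).
  assert (Hxi : (xi < 0)%R) by (unfold xi; nra).
  assert (Hti : (tau + xi < 0)%R) by (unfold xi, tau; lra).
  set (rho := Rmin (- xi) (- (tau + xi))).
  assert (Hrho : (0 < rho)%R) by (apply Rmin_glb_lt; lra).
  destruct (quad_exponent_bound (- ln q) tau xi (Re z * ln q) (Re nu) rho) as [K HK];
    [lra|exact Hrho| | |].
  { generalize (Rmin_l (- xi) (- (tau + xi))). fold rho. lra. }
  { generalize (Rmin_r (- xi) (- (tau + xi))). fold rho. lra. }
  pose (cc := Cexp (nu * logr + ln q * (nu * y + nu * nu + x * z) / 2)
               / (qpoch_inf q q * qpoch_inf q q)).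
  set (c0 := Cmod cc).
  set (X0 := exp (exp (Re x * ln q) / (1 - q))).
  set (Q0 := exp (/ (1 - q) ^ 2)).
  set (M := (c0 * B * X0 * (Q0 * Q0 * Q0 * Q0))%R).
  assert (Hc0 : (0 <= c0)%R) by apply Cmod_ge_0.
  assert (HX0 : (0 < X0)%R) by apply exp_pos.
  assert (HQ0 : (0 < Q0)%R) by apply exp_pos.
  set (delta := exp (- (rho / 3))).
  assert (Hdel : (0 <= delta < 1)%R).
  { split; [left; apply exp_pos|apply exp_neg_lt1; lra]. }
  apply summable_le with (fun p : nat * nat * nat * nat =>
    (M * exp K) * (delta ^ fst (fst (fst p)) * delta ^ snd (fst (fst p))
                   * delta ^ snd (fst p) * delta ^ snd p))%R.
  - intros [[[j b] d] m]. cbn [fst snd]. unfold quad_term.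
    fold cc. clearbody cc.
    rewrite !Cmod_mult, !Cmod_neg1_pow, !Rmult_1_r, Cmod_Cexp. fold c0.
    set (g := Cmod (gtail q nu (Z.of_nat (j + b) - Z.of_nat m))).
    specialize (HB (Z.of_nat (j + b) - Z.of_nat m)%Z). fold g in HB.
    set (Gx := (if (0 <=? Z.of_nat (j + b) - Z.of_nat m)%Z
       then (ln q * (Re nu * IZR (Z.of_nat (j + b) - Z.of_nat m)
             + IZR (Z.of_nat (j + b) - Z.of_nat m)
               * (IZR (Z.of_nat (j + b) - Z.of_nat m) + 1) / 2))%R
       else 0%R)).
    assert (HB' : (g <= B * exp Gx)%R).
    { eapply Rle_trans; [exact HB|]. unfold Gx.
      destruct (0 <=? Z.of_nat (j + b) - Z.of_nat m)%Z; [lra|rewrite exp_0; lra]. }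
    match goal with |- (_ * exp ?e <= _)%R => set (ex := e) end.
    assert (Hex : ex = ((INR j + INR b) * tau + INR m * xi
       - - ln q * (INR j * (INR j - 1) / 2 + INR d * (INR d + 1) / 2 - INR j * INR d
                  + INR m * INR d) + INR d * (Re z * ln q))%R).
    { unfold ex, tau, xi. rewrite plus_INR, RtoC_plus.
      destruct logr as [l1 l2], x as [x1 x2], y as [y1 y2], z as [z1 z2]. simpl. field. }
    assert (Hbd : (Gx + ex <= K - rho / 3 * (INR j + INR b + INR d + INR m))%R).
    { rewrite Hex.
      assert (El : IZR (Z.of_nat (j + b) - Z.of_nat m) = (INR j + INR b - INR m)%R).
      { rewrite minus_IZR, <- !INR_IZR_INZ, plus_INR. reflexivity. }
      apply HK; try apply pos_INR.
      - intros H. unfold Gx. rewrite El.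
        destruct (Z.leb_spec 0 (Z.of_nat (j + b) - Z.of_nat m)) as [H'|H'].
        + right; ring.
        + exfalso. apply IZR_lt in H'. rewrite El in H'. lra.
      - intros H. unfold Gx.
        destruct (Z.leb_spec 0 (Z.of_nat (j + b) - Z.of_nat m)) as [H'|H']; [|lra].
        exfalso. apply IZR_le in H'. rewrite El in H'. lra. }
    assert (HX : (Cmod (qpoch_inf (qpow q (x + INR d + 1)) q) <= X0)%R).
    { apply qpoch_inf_qpow_bound; [exact Hq|]. generalize (pos_INR d).
      destruct x; simpl; lra. }
    assert (HQ : forall k, (Cmod (/ qpoch q q k) <= Q0)%R)
      by (intros k; apply Cinv_qpoch_bound, Hq).
    apply Rle_trans with
      (c0 * (B * exp Gx) * X0 * (Q0 * Q0 * Q0 * Q0) * exp ex)%R.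
    + apply Rmult_le_compat_r; [left; apply exp_pos|].
      assert (H0 : forall c : C, (0 <= Cmod c)%R) by apply Cmod_ge_0.
      repeat apply Rmult_le_compat; repeat apply Rmult_le_pos;
        try apply H0; try apply HQ; try lra; assumption.
    + replace (c0 * (B * exp Gx) * X0 * (Q0 * Q0 * Q0 * Q0) * exp ex)%R
        with (M * (exp Gx * exp ex))%R by (unfold M; ring).
      rewrite Rmult_assoc. apply Rmult_le_compat_l.
      { unfold M. repeat apply Rmult_le_pos; lra. }
      unfold delta. rewrite <- !exp_pow, <- !exp_plus. apply exp_mono. lra.
  - apply summable_scal.
    { apply Rmult_le_pos; [|left; apply exp_pos].
      unfold M. repeat apply Rmult_le_pos; lra. }
    assert (Hg := summable_geom delta Hdel).
    assert (Hp : forall n, (0 <= delta ^ n)%R) by (intros n; apply pow_le, Hdel).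
    apply (summable_prod (fun p : nat * nat * nat =>
        delta ^ fst (fst p) * delta ^ snd (fst p) * delta ^ snd p)%R (fun m => delta ^ m)%R);
      [intros p; repeat apply Rmult_le_pos; apply Hp|exact Hp| |exact Hg].
    apply (summable_prod (fun p : nat * nat =>
        delta ^ fst p * delta ^ snd p)%R (fun m => delta ^ m)%R);
      [intros p; repeat apply Rmult_le_pos; apply Hp|exact Hp| |exact Hg].
    apply (summable_prod (fun m => delta ^ m)%R (fun m => delta ^ m)%R); assumption.
Qed.

(** * Evaluation of the quadruple series *)

(** The value of the sum over m of the quadruple series, with n = j + b. *)
Definition triple_term (q : R) (logr x y nu z : C) (n j b d : nat) : C :=
  Cexp (nu * logr + ln q * (nu * y + nu * nu + x * z) / 2)
  / (qpoch_inf q q * qpoch_inf q q)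
  * ((- (1)) ^ b * (- (1)) ^ d)
  * gtail q nu (Z.of_nat n)
  * qpoch_inf (qpow q (x - nu - INR n + INR d + 1)) q
  * (/ qpoch q q j * / qpoch q q b * / qpoch q q d)
  * Cexp (INR n * (2 * logr + y * ln q)
          + ln q * (INR j * (INR j - 1) / 2 + INR d * (INR d + 1) / 2
                    - INR j * INR d) + INR d * (z * ln q)).

(** The q-binomial theorem with a = q^(-nu-n) and argument w = q^(x+1+d); the
    product (q^(x+d+1);q)_oo of the third Bessel function is (w;q)_oo, which
    the theorem replaces by (a w;q)_oo. *)
Lemma has_sum_quad_m (q : R) (logr x y nu z : C) (j b d : nat) : (0 < q < 1)%R ->
  (Re x > -1)%R ->
  has_sum (quad_term q logr x y nu z j b d) (triple_term q logr x y nu z (j + b) j b d).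
Proof.
  intros Hq Hx. assert (HL := ln_neg q Hq).
  set (w := qpow q (x + 1 + INR d)).
  assert (Hw : (Cmod w < 1)%R).
  { unfold w. rewrite Cmod_qpow. apply exp_neg_lt1. generalize (pos_INR d).
    destruct x as [x1 x2]; simpl in *. nra. }
  set (a := qpow q (- nu - INR (j + b))).
  destruct (q_binomial q a w Hq Hw) as [F [HF EF]].
  replace (a * w) with (qpow q (x - nu - INR (j + b) + INR d + 1)) in EF
    by (unfold a, w; rewrite <- qpow_plus; f_equal; ring).
  unfold triple_term. rewrite <- EF.
  set (c0 := Cexp (nu * logr + _) / _). set (g := gtail q nu (Z.of_nat (j + b))).
  set (e := Cexp (INR (j + b) * _ + _ + _)).
  set (c := c0 * ((- (1)) ^ b * (- (1)) ^ d) * g * qpoch_inf w q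
             * (/ qpoch q q j * / qpoch q q b * / qpoch q q d) * e).
  match goal with |- has_sum _ ?l => replace l with (c * F) by (unfold c; ring) end.
  apply has_sum_ext with (2 := has_sum_scal c _ _ HF). intros m.
  unfold quad_term. fold c0. rewrite gtail_minus by exact Hq. fold g.
  rewrite <- INR_IZR_INZ. fold a.
  replace (x + INR d + 1) with (x + 1 + INR d) by ring. fold w.
  match goal with |- _ = _ * Cexp ?b1 => replace (Cexp b1) with (e * w ^ m) end.
  2:{ unfold e, w, qpow. rewrite <- Cexp_nat, <- Cexp_plus. f_equal. ring. }
  unfold c, Cdiv.
  transitivity (c0 * ((- (1)) ^ b * (- (1)) ^ d) * g * qpoch_inf w q
             * (/ qpoch q q j * / qpoch q q b * / qpoch q q d) * e
             * (qpoch a q m * / qpoch q q m * w ^ m) * ((- (1)) ^ m * (- (1)) ^ m));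
    [rewrite neg1_sqr; ring|ring].
Qed.

(** The value of the sum over j + b = n, which vanishes for d < n because of the
    factor (q^(-d);q)_n. *)
Definition double_term (q : R) (logr x y nu z : C) (n d : nat) : C :=
  Cexp (nu * logr + ln q * (nu * y + nu * nu + x * z) / 2)
  / (qpoch_inf q q * qpoch_inf q q)
  * ((- (1)) ^ n * (- (1)) ^ d)
  * gtail q nu (Z.of_nat n)
  * qpoch_inf (qpow q (x - nu - INR n + INR d + 1)) q
  * (qpoch (qpow q (- INR d)) q n / qpoch q q n * / qpoch q q d)
  * Cexp (INR n * (2 * logr + y * ln q)
          + ln q * (INR d * (INR d + 1) / 2) + INR d * (z * ln q)).

(** The finite q-binomial theorem at u = q^(-d). *)
Lemma csum_triple (q : R) (logr x y nu z : C) (n d : nat) : (0 < q < 1)%R ->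
  csum (fun j => triple_term q logr x y nu z n j (n - j) d) (seq 0 (S n))
  = double_term q logr x y nu z n d.
Proof.
  intros Hq. unfold double_term.
  assert (ES := finite_q_binomial q (qpow q (- INR d)) n Hq).
  set (S0 := csum _ (seq 0 (S n))) in ES. rewrite <- ES.
  set (c0 := Cexp (nu * logr + _) / _). set (g := gtail q nu (Z.of_nat n)).
  set (h := qpoch_inf _ q). set (e := Cexp (INR n * _ + _ + _)).
  set (c := c0 * ((- (1)) ^ n * (- (1)) ^ d) * g * h * / qpoch q q d * e).
  transitivity (c * S0); [|unfold c; ring]. unfold S0. rewrite <- csum_scal.
  apply csum_ext. intros j Hj%in_seq. unfold triple_term. fold c0 g h.
  match goal with |- _ * Cexp ?b1 = _ =>
    replace (Cexp b1) with (e * qpow q (INR j * (INR j - 1) / 2) * qpow q (- INR d) ^ j) end.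
  2:{ unfold e, qpow. rewrite <- Cexp_nat, <- !Cexp_plus. f_equal. field. }
  assert (Es : (- (1)) ^ (n - j) = (- (1)) ^ n * (- (1)) ^ j).
  { replace n with ((n - j) + j)%nat at 2 by lia. rewrite Cpow_add_r.
    transitivity ((- (1)) ^ (n - j) * ((- (1)) ^ j * (- (1)) ^ j));
      [rewrite neg1_sqr; ring|ring]. }
  rewrite Es. unfold c, Cdiv.
  assert (H1 := qpoch_q_neq0 q j Hq). assert (H2 := qpoch_q_neq0 q (n - j) Hq).
  assert (H3 := qpoch_q_neq0 q d Hq).
  field. tauto.
Qed.

(** After the shift d -> n + d of the nonvanishing terms, the double series
    splits into the product of the two Bessel series of the left-hand side. *)
Lemma double_term_shift (q : R) (logr x y nu z : C) (n d : nat) : (0 < q < 1)%R ->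
  double_term q logr x y nu z n (n + d)
  = Cexp (nu * logr + (y + z + nu) / 2 * nu * ln q)
    * Cexp (z / 2 * (x - nu) * ln q)
    * (hterm q nu (2 * logr + 2 * ((y + z + nu) / 2) * ln q) n
       * hterm q (x - nu) (2 * (z / 2) * ln q) d).
Proof.
  intros Hq. unfold double_term, hterm, gtail.
  rewrite <- INR_IZR_INZ.
  replace (x - nu - INR n + INR (n + d) + 1) with (x - nu + INR d + 1)
    by (rewrite plus_INR, RtoC_plus; ring).
  assert (H1 := qpoch_q_neq0 q n Hq). assert (H2 := qpoch_q_neq0 q d Hq).
  assert (H3 := qpoch_q_neq0 q (n + d) Hq).
  set (P := qpoch_inf q q).
  assert (HP : P <> 0) by exact (qpoch_inf_q_neq0 q Hq).
  replace (qpoch (qpow q (- INR (n + d))) q n / qpoch q q n * / qpoch q q (n + d))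
    with ((- (1)) ^ n * qpow q (- (INR (n + d) * INR n) + INR n * (INR n - 1) / 2)
          / (qpoch q q n * qpoch q q d)).
  2:{ assert (E := qpoch_qpow_neg q n d Hq).
      set (u := qpoch (qpow q _) q n) in *.
      transitivity ((- (1)) ^ n * qpow q (- (INR (n + d) * INR n) + INR n * (INR n - 1) / 2)
        * qpoch q q (n + d) / (qpoch q q n * qpoch q q d * qpoch q q (n + d))); [field; tauto|].
      rewrite <- E. field. tauto. }
  rewrite (Cpow_add_r _ n d).
  set (g := qpoch_inf (qpow q (nu + INR n + 1)) q).
  set (h := qpoch_inf (qpow q (x - nu + INR d + 1)) q).
  unfold qpow.
  match goal with |- Cexp ?b1 / _ * _ * (Cexp ?b2 * _) * _ * (_ * Cexp ?b3 / _) * Cexp ?b4 =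
     Cexp ?a1 * Cexp ?a2 * (_ * Cexp ?a3 * (_ * Cexp ?a4)) =>
   assert (E : Cexp b1 * Cexp b2 * Cexp b3 * Cexp b4
               = Cexp a1 * Cexp a2 * Cexp a3 * Cexp a4) by
     (rewrite <- !Cexp_plus; f_equal; rewrite plus_INR, RtoC_plus; field);
   generalize dependent (Cexp a1); intros A1;
   generalize dependent (Cexp a2); intros A2;
   generalize dependent (Cexp a3); intros A3;
   generalize dependent (Cexp a4); intros A4;
   generalize dependent (Cexp b1); intros B1;
   generalize dependent (Cexp b2); intros B2;
   generalize dependent (Cexp b3); intros B3;
   generalize dependent (Cexp b4); intros B4
  end.
  intros E. set (s := (- (1)) ^ n). set (t := (- (1)) ^ d).
  assert (Hs : s * s = 1) by apply neg1_sqr.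
  transitivity (B1 * B2 * B3 * B4 * (s * s) * (s * t) * g * h
     / (P * P * qpoch q q n * qpoch q q d)); [field; tauto|].
  rewrite E, Hs. field. tauto.
Qed.

(** The three summations, over m, over j + b = n, and over (n, d), in this
    order. *)
Lemma has_sum_quad_term (q : R) (logr x y nu z : C) : (0 < q < 1)%R ->
  (Re x > -1)%R -> (2 * Re logr + (1 + Re x + Re y) * ln q < 0)%R ->
  has_sum (fun p : nat * nat * nat * nat => quad_term q logr x y nu z
            (fst (fst (fst p))) (snd (fst (fst p))) (snd (fst p)) (snd p))
    (Cexp (nu * logr + (y + z + nu) / 2 * nu * ln q)
    * Cexp (z / 2 * (x - nu) * ln q)
    * (hsum q nu (2 * logr + 2 * ((y + z + nu) / 2) * ln q)
       * hsum q (x - nu) (2 * (z / 2) * ln q))).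
Proof.
  intros Hq Hx Hxy.
  destruct (summable_has_sum _ (summable_quad_term q logr x y nu z Hq Hx Hxy)) as [l Hl].
  match goal with |- has_sum _ ?rhs => replace rhs with l; [exact Hl|] end.
  assert (H3 : has_sum (fun p : nat * nat * nat =>
     triple_term q logr x y nu z (fst (fst p) + snd (fst p))
       (fst (fst p)) (snd (fst p)) (snd p)) l).
  { apply (has_sum_fubini (fun (p : nat * nat * nat) (m : nat) =>
      quad_term q logr x y nu z (fst (fst p)) (snd (fst p)) (snd p) m)); [exact Hl|].
    intros p. apply has_sum_quad_m; assumption. }
  assert (H2 : has_sum (fun p : nat * nat =>
     double_term q logr x y nu z (fst p) (snd p)) l).
  { (* index b is n - j, and (n, d, j) ranges over all triples after extension by 0 *)
    pose (T := fun (p : nat * nat) (j : nat) => if Nat.leb j (fst p)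
        then triple_term q logr x y nu z (fst p) j (fst p - j) (snd p) else RtoC 0).
    apply (has_sum_fubini T).
    - apply has_sum_extend with
        (phi := fun p : nat * nat * nat =>
                  ((fst (fst p) + snd (fst p), snd p), fst (fst p))%nat).
      + intros [[j b] d] [[j' b'] d'] E. cbn [fst snd] in E. inversion E; subst.
        repeat f_equal. lia.
      + intros [[n d] j] Hn. unfold T. cbn [fst snd].
        destruct (Nat.leb_spec j n) as [Hj|Hj]; [|reflexivity].
        exfalso. apply (Hn ((j, (n - j)%nat), d)). cbn [fst snd]. repeat f_equal. lia.
      + apply has_sum_ext with (2 := H3). intros [[j b] d]. unfold T. cbn [fst snd].
        destruct (Nat.leb_spec j (j + b)) as [Hj|Hj]; [|lia].
        f_equal. lia.
    - intros [n d]. cbn [fst snd]. rewrite <- csum_triple by exact Hq.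
      rewrite (csum_ext _ (T (n, d))).
      + apply has_sum_finite; [apply seq_NoDup|].
        intros j Hj. unfold T. cbn [fst snd].
        destruct (Nat.leb_spec j n); [|reflexivity].
        exfalso. apply Hj, in_seq. lia.
      + intros j Hj%in_seq. unfold T. cbn [fst snd].
        destruct (Nat.leb_spec j n); [reflexivity|lia]. }
  apply (has_sum_unique _ _ _ H2).
  apply has_sum_extend with (phi := fun p : nat * nat => (fst p, (fst p + snd p)%nat)).
  - intros [n d] [n' d'] E. cbn [fst snd] in E. inversion E; subst. f_equal. lia.
  - intros [n d] Hn. unfold double_term. cbn [fst snd].
    rewrite qpoch_qpow_neg_eq0; [unfold Cdiv; ring|exact Hq|].
    destruct (Nat.lt_ge_cases d n) as [H|H]; [exact H|].
    exfalso. apply (Hn (n, (d - n)%nat)). cbn [fst snd]. f_equal. lia.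
  - cbn [fst snd]. eapply has_sum_ext.
    { intros p. symmetry. apply double_term_shift, Hq. }
    apply has_sum_scal. apply has_sum_prod; auto using summable_hterm, has_sum_hterm.
Qed.

(** * The addition formula *)

(** Transport from (j, b, d, m) to k = j - m and (m, b, d); the terms that are
    not reached have k + m < 0 and vanish. *)
Lemma rhs_total (q : R) (logr x y nu z : C) : (0 < q < 1)%R ->
  (Re x > -1)%R -> (2 * Re logr + (1 + Re x + Re y) * ln q < 0)%R ->
  summable (fun u : Z * (nat * nat * nat) =>
    Cmod (rhs_term q logr x y nu z (fst u) (snd u))) /\
  has_sum (fun u : Z * (nat * nat * nat) => rhs_term q logr x y nu z (fst u) (snd u))
    (Cexp (nu * logr + (y + z + nu) / 2 * nu * ln q)
    * Cexp (z / 2 * (x - nu) * ln q)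
    * (hsum q nu (2 * logr + 2 * ((y + z + nu) / 2) * ln q)
       * hsum q (x - nu) (2 * (z / 2) * ln q))).
Proof.
  intros Hq Hx Hxy.
  pose (phi := fun p : nat * nat * nat * nat =>
    ((Z.of_nat (fst (fst (fst p))) - Z.of_nat (snd p))%Z,
     ((snd p, snd (fst (fst p))), snd (fst p)))).
  assert (Hinj : forall p p', phi p = phi p' -> p = p').
  { intros [[[j b] d] m] [[[j' b'] d'] m'] E. unfold phi in E. cbn [fst snd] in E.
    inversion E; subst. repeat f_equal. lia. }
  assert (H0 : forall u : Z * (nat * nat * nat), (forall p, phi p <> u) ->
    rhs_term q logr x y nu z (fst u) (snd u) = 0).
  { intros [k [[m b] d]] Hn. apply rhs_term_neg; [exact Hq|]. cbn [fst snd].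
    apply Z.lt_nge. intros Hk.
    apply (Hn (((Z.to_nat (k + Z.of_nat m), b), d), m)). unfold phi. cbn [fst snd].
    repeat f_equal. lia. }
  assert (Hphi : forall p, rhs_term q logr x y nu z (fst (phi p)) (snd (phi p))
    = quad_term q logr x y nu z
        (fst (fst (fst p))) (snd (fst (fst p))) (snd (fst p)) (snd p)).
  { intros p. unfold phi. cbn [fst snd]. apply rhs_term_quad, Hq. }
  split.
  - apply summable_extend with (phi := phi); [exact Hinj| |].
    + intros u Hu. rewrite H0 by exact Hu. apply Cmod_0.
    + apply summable_le with (2 := summable_quad_term q logr x y nu z Hq Hx Hxy).
      intros p. rewrite Hphi. lra.
  - apply has_sum_extend with (phi := phi); [exact Hinj|exact H0|].
    apply has_sum_ext with (2 := has_sum_quad_term q logr x y nu z Hq Hx Hxy).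
    intros p. symmetry. apply Hphi.
Qed.

Lemma has_sum_rhs_term (q : R) (logr x y nu z : C) (k : Z) : (0 < q < 1)%R ->
  has_sum (rhs_term q logr x y nu z k)
   (Cexp (IZR k * logr + (x + y + IZR k) / 2 * IZR k * ln q)
  * Cexp ((nu + IZR k) * logr + (y + IZR k + nu) / 2 * (nu + IZR k) * ln q)
  * Cexp ((z - IZR k) / 2 * x * ln q)
  * (hsum q (IZR k) (2 * logr + 2 * ((x + y + IZR k) / 2) * ln q)
     * hsum q (nu + IZR k) (2 * logr + 2 * ((y + IZR k + nu) / 2) * ln q)
     * hsum q x (2 * ((z - IZR k) / 2) * ln q))).
Proof.
  intros Hq. apply has_sum_scal.
  set (f1 := hterm q (IZR k) _). set (f2 := hterm q (nu + IZR k) _).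
  apply (has_sum_prod (fun p : nat * nat => f1 (fst p) * f2 (snd p)));
    [|apply summable_hterm, Hq| |apply has_sum_hterm, Hq].
  - eapply summable_le; [intros p; rewrite Cmod_mult; apply Rle_refl|].
    apply (summable_prod (fun m => Cmod (f1 m)) (fun m => Cmod (f2 m)));
      auto using Cmod_ge_0, summable_hterm;
      [apply summable_hterm, Hq|apply summable_hterm, Hq].
  - apply has_sum_prod; [apply summable_hterm, Hq|apply summable_hterm, Hq
      |apply has_sum_hterm, Hq|apply has_sum_hterm, Hq].
Qed.

Theorem mainTheorem1 (q : R) (z : Z) (r logr x y nu : C)
  (hq0 : (0 < q)%R) (hq1 : (q < 1)%R)
  (hr : r <> 0) (hlogr : Cexp logr = r)
  (hx : (Re x > -1)%R)
  (hxy : (Rpower q (1 + Re x + Re y) * Cmod r ^ 2 < 1)%R) :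
  is_biseries
    (fun k : Z =>
       J_Rqpow q r logr (IZR k) ((x + y + IZR k) / 2)
       * J_Rqpow q r logr (nu + IZR k) ((y + IZR k + nu) / 2)
       * J_qpow q x ((IZR z - IZR k) / 2))
    (J_Rqpow q r logr nu ((y + IZR z + nu) / 2)
     * J_qpow q (x - nu) (IZR z / 2)).
Proof.
  assert (Hq : (0 < q < 1)%R) by (split; assumption).
  assert (Hxy : (2 * Re logr + (1 + Re x + Re y) * ln q < 0)%R).
  { rewrite <- hlogr, Cmod_Cexp in hxy. unfold Rpower in hxy.
    rewrite <- exp_pow, <- exp_plus in hxy. change (INR 2) with 2%R in hxy.
    apply exp_lt_inv. rewrite exp_0, Rplus_comm. exact hxy. }
  destruct (rhs_total q logr x y nu (IZR z) Hq hx Hxy) as [HS Hl].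
  rewrite (J_Rqpow_hsum q r logr nu _ Hq hlogr), J_qpow_hsum by exact Hq.
  match type of Hl with has_sum _ ?l => match goal with |- is_biseries _ ?l' =>
    replace l' with l by ring end end.
  apply (is_biseries_fubini (rhs_term q logr x y nu (IZR z)) _ _ HS Hl).
  intros k. rewrite !(J_Rqpow_hsum q r logr _ _ Hq hlogr), J_qpow_hsum by exact Hq.
  match goal with |- has_sum _ ?l' => match type of (has_sum_rhs_term q logr x y nu (IZR z) k Hq)
    with has_sum _ ?l => replace l' with l by ring end end.
  apply has_sum_rhs_term, Hq.
Qed.
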